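(* Let $p$ be a prime and let $F$ be a non-abelian free group of finite rank. Then $\mathrm{Comm}_p(F)$ contains a simple subgroup of index at most two.
   Context: The pro-$p$ topology on a group $G$ is the group topology in which the normal subgroups of $G$ of finite $p$-power index form a base of neighborhoods of the identity. A subgroup is $p$-open if it is open in the pro-$p$ topology. The $p$-commensurator $\mathrm{Comm}_p(G)$ is the group of equivalence classes $[f]$ of isomorphisms $f:U\to V$ between $p$-open subgroups of $G$, where two such isomorphisms are equivalent if they coincide on some $p$-open subgroup of $G$, with product $[f_1][f_2]=[f_1\circ f_2]$ (for $f_i:U_i\to V_i$, the composition is defined on $f_2^{-1}(V_2\cap U_1)$). *)

(* Defs.v *)
From HB Require Import structures.
From mathcomp Require Import all_boot all_fingroup all_solvable.
From mathcomp Require Import boolp classical_sets functions cardinality filter.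
From mathcomp Require Import topology.

Set Implicit Arguments.
Unset Strict Implicit.
Unset Printing Implicit Defensive.

Local Open Scope classical_set_scope.
Local Open Scope card_scope.
Local Open Scope quotient_scope.
Local Open Scope group_scope.

(* Groups are arbitrary, possibly infinite, [groupType]s; their subsets are   *)
(* elements of [set G].                                                       *)

Section Subgroups.
Variable G : groupType.
Implicit Types H N : set G.

Definition subgroup H : Prop := group_closed [in H].

Definition normal_in N H : Prop :=
  [/\ subgroup N, N `<=` H & forall n x, N n -> H x -> N (n ^ x)].

Definition left_coset (x : G) H : set G := [set x * h | h in H].

Definition left_cosets H : set (set G) := range (fun x => left_coset x H).

Definition simple_subgroup H : Prop :=
  [/\ subgroup H, H <> [set 1]
    & forall N, normal_in N H -> N = [set 1] \/ N = H].

(* When [p] is prime, [p.-nat k] says that [k] is a power of [p].             *)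
Definition p_normal (p : nat) N : Prop :=
  normal_in N setT /\ exists2 k, p.-nat k & left_cosets N #= `I_k.

Lemma subgroupP H :
  subgroup H <-> H 1 /\ forall x y, H x -> H y -> H (x * y^-1).
Proof.
split=> -[H1 HM]; split.
- by move: H1; rewrite !inE.
- by move=> x y Hx Hy; have := HM x y; rewrite !inE; apply.
- by rewrite !inE.
- by move=> x y; rewrite !inE; exact: HM.
Qed.

Lemma subgroup1 H : subgroup H -> H 1.
Proof. by case/subgroupP. Qed.

Lemma subgroupV H x : subgroup H -> H x -> H x^-1.
Proof.
by move=> /subgroupP[H1 HM] Hx; rewrite -[x^-1]mul1g; exact: HM.
Qed.

Lemma subgroupM H x y : subgroup H -> H x -> H y -> H (x * y).
Proof.
move=> sH Hx Hy; rewrite -[y]invgK.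
by case/subgroupP: (sH) => _; apply=> //; exact: subgroupV.
Qed.

Lemma subgroupX H x n : subgroup H -> H x -> H (x ^+ n).
Proof.
move=> sH Hx; elim: n => [|n IHn]; first by rewrite expg0; exact: subgroup1.
by rewrite expgS; exact: subgroupM.
Qed.

Lemma subgroupT : subgroup setT.
Proof. exact/subgroupP. Qed.

Lemma subgroupI H K : subgroup H -> subgroup K -> subgroup (H `&` K).
Proof.
move=> /subgroupP[H1 HM] /subgroupP[K1 KM]; apply/subgroupP; split=> //.
by move=> x y [? ?] [? ?]; split; [exact: HM|exact: KM].
Qed.

Lemma lcoset_eqP H x y :
  subgroup H -> (left_coset x H = left_coset y H) <-> H (x^-1 * y).
Proof.
move=> sH; split=> [xHyH|Hxy].
  have : (left_coset y H) y by exists 1; [exact: subgroup1|rewrite mulg1].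
  by rewrite -xHyH => -[h Hh <-]; rewrite mulKg.
apply/seteqP; split=> [_ [h Hh <-]|_ [h Hh <-]].
  exists (y^-1 * x * h); last by rewrite !mulgA mulgV mul1g.
  apply: subgroupM => //; rewrite -[y^-1 * x]invgK; apply: subgroupV => //.
  by rewrite invgM invgK.
exists (x^-1 * y * h); last by rewrite !mulgA mulgV mul1g.
exact: subgroupM.
Qed.

Lemma finite_lcosets H (T : Type) (c : G -> T) : subgroup H ->
    finite_set (range c) -> (forall x y, c x = c y -> H (x^-1 * y)) ->
  finite_set (left_cosets H).
Proof.
move=> sH fc cH.
pose g t : set G := left_coset (xget 1 [set x | c x = t]) H.
apply: (sub_finite_set _ (finite_image g fc)) => _ [x _ <-].
exists (c x); first by exists x.
apply/lcoset_eqP => //; apply: cH.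
by apply: (@xgetPex _ 1 [set z | c z = c x]); exists x.
Qed.

Lemma lcosets_ord H : subgroup H -> finite_set (left_cosets H) ->
  exists n (c : G -> 'I_n), (forall x y, c x = c y <-> H (x^-1 * y)) /\
                            forall i, exists x, c x = i.
Proof.
move=> sH [n /card_set_bijP[g [gfun ginj gsurj]]].
have ltg x : (g (left_coset x H) < n)%N by apply: gfun; exists x.
exists n, (fun x => Ordinal (ltg x)).
split=> [x y|i]; last first.
  have [_ [x _ <-] gi] := gsurj i (ltn_ord i).
  by exists x; apply: val_inj.
split=> [[/ginj eqc]|Hxy].
  by apply/lcoset_eqP => //; apply: eqc; apply/mem_set; [exists x|exists y].
by apply: val_inj => /=; congr g; exact/lcoset_eqP.
Qed.

Lemma coset_perm_rep H : subgroup H -> finite_set (left_cosets H) ->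
  exists (gT : finGroupType) (f : G -> gT),
    {morph f : x y / x * y} /\ forall x, f x = 1 <-> forall t, H (x ^ t).
Proof.
move=> sH /(lcosets_ord sH)[n [c [cE csurj]]].
have /choice[r rE] := csurj.
have cM z x : c (z * r (c x)) = c (z * x).
  apply/cE; rewrite invgM -mulgA mulKg.
  by apply/cE; rewrite rE.
pose a x i := c (x^-1 * r i).
have aM x y i : a y (a x i) = a (x * y) i by rewrite /a cM invgM mulgA.
have a1 i : a 1 i = i by rewrite /a invg1 mul1g rE.
have ainj x : injective (a x).
  by apply: (@can_inj _ _ _ (a x^-1)) => i; rewrite aM mulgV a1.
exists {perm 'I_n}, (fun x => perm (ainj x)); split=> [x y|x].
  by apply/permP => i; rewrite permM !permE aM.
split=> [fx1 t|Hx].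
  have : a x (c t) = c t by rewrite -(permE (ainj x)) fx1 perm1.
  by rewrite /a cM => /cE; rewrite invgM invgK -mulgA.
apply/permP => i; rewrite permE perm1 /a -{2}(rE i).
by apply/cE; rewrite invgM invgK -mulgA; exact: Hx.
Qed.

End Subgroups.

Section HomKernel.
Variables (G : groupType) (gT : finGroupType) (f : G -> gT).
Hypothesis fM : {morph f : x y / x * y}.

Let f1 : f 1 = 1.
Proof. by apply: (mulgI (f 1)); rewrite -fM !mulg1. Qed.

Let fV x : f x^-1 = (f x)^-1.
Proof. by apply: (mulgI (f x)); rewrite -fM !mulgV. Qed.

Lemma hom_expg x n : f (x ^+ n) = f x ^+ n.
Proof. by elim: n => [|n IHn]; rewrite ?expg0 // !expgS fM IHn. Qed.

Definition hom_img := [set y : gT | `[< exists x, f x = y >]]%SET.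

Lemma hom_img_group_set : group_set hom_img.
Proof.
apply/group_setP; split; first by rewrite !inE; exists 1.
move=> u v; rewrite !inE => -[x <-] [y <-].
by exists (x * y).
Qed.
Canonical hom_img_group := Group hom_img_group_set.

Lemma mem_hom_img x : f x \in hom_img.
Proof. by rewrite !inE; exists x. Qed.

Lemma hom_ker_subgroup : subgroup [set x | f x = 1].
Proof.
by apply/subgroupP; split=> //= x y fx fy; rewrite fM fV fx fy mulgV.
Qed.

Lemma hom_ker_index : left_cosets [set x | f x = 1] #= `I_#|hom_img|.
Proof.
pose N := [set x | f x = 1]; have sN : subgroup N := hom_ker_subgroup.
pose r (A : set G) : nat := enum_rank_in (mem_hom_img 1) (f (xget 1 A)).
have rE x : r (left_coset x N) = enum_rank_in (mem_hom_img 1) (f x).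
  rewrite /r; congr (nat_of_ord (enum_rank_in _ _)).
  have [|n Nn <-] := @xgetPex _ 1 (left_coset x N); last by rewrite fM Nn mulg1.
  by exists x, 1; rewrite ?mulg1.
apply/card_set_bijP; exists r; split.
- by move=> _ [x _ <-]; rewrite rE /=; exact: ltn_ord.
- move=> _ _ /set_mem[x _ <-] /set_mem[y _ <-]; rewrite !rE => /val_inj.
  move=> /(enum_rank_in_inj (mem_hom_img x) (mem_hom_img y)) fxy.
  by apply/lcoset_eqP => //; rewrite /N /= fM fV fxy mulVg.
- move=> i /= ltin; pose y := enum_val (Ordinal ltin).
  have := enum_valP (Ordinal ltin); rewrite -/y !inE => -[x fx].
  exists (left_coset x N); first by exists x.
  by rewrite rE fx /y enum_valK_in.
Qed.

End HomKernel.

Section ProPNormal.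
Variables (p : nat) (G : groupType).
Implicit Types H K N U : set G.

Lemma p_normalP N : p_normal p N <->
  [/\ normal_in N setT, finite_set (left_cosets N)
    & exists2 m, p.-nat m & forall x, N (x ^+ m)].
Proof.
have rep : normal_in N setT -> finite_set (left_cosets N) ->
    exists (gT : finGroupType) (f : G -> gT),
      {morph f : x y / x * y} /\ N = [set x | f x = 1].
  move=> [sN _ nN] /(coset_perm_rep sN)[gT [f [fM fE]]].
  exists gT, f; split=> //; apply/seteqP; split=> x /=.
    by move=> Nx; apply/fE => t; exact: nN.
  by move/fE/(_ 1); rewrite conjg1.
split=> [[nN [k pk Nk]]|[nN fN [m pm Nm]]].
  have fN : finite_set (left_cosets N) by exists k.
  split=> //; exists k => // x.
  have [gT [f [fM NE]]] := rep nN fN.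
  suff -> : k = #|hom_img f|.
    rewrite NE /= hom_expg //.
    exact: (@expg_cardG _ (hom_img_group fM) _ (mem_hom_img f x)).
  apply/card_eq_II; apply: card_eq_trans (hom_ker_index fM).
  by rewrite -NE card_eq_sym.
split=> //; have [gT [f [fM NE]]] := rep nN fN.
exists #|hom_img f|; last by rewrite {1}NE; exact: hom_ker_index.
apply/(@pgroupP _ p (hom_img_group fM)) => q q_pr.
case/(Cauchy q_pr) => y; rewrite !inE => -[x <-] fxq.
have := Nm x; rewrite NE /= hom_expg // => /eqP; rewrite -order_dvdn fxq.
by case/andP: (pm) => m_gt0 _; move/(pnatP _ m_gt0): pm; apply.
Qed.

Lemma p_normalT : p_normal p [set: G].
Proof.
apply/p_normalP; split; [by split=> //; exact: subgroupT| |by exists 1%N].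
apply: (@finite_lcosets _ _ unit (fun=> tt)) => //; exact: subgroupT.
Qed.

Lemma p_normalI N M : p_normal p N -> p_normal p M -> p_normal p (N `&` M).
Proof.
move=> /p_normalP[[sN _ nN] fN [m pm Nm]] /p_normalP[[sM _ nM] fM [k pk Mk]].
have sNM : subgroup (N `&` M) by exact: subgroupI.
apply/p_normalP; split.
- by split=> // n x [Nn Mn] _; split; [exact: nN|exact: nM].
- pose c x := (left_coset x N, left_coset x M).
  apply: (@finite_lcosets _ _ _ c) => //.
    apply: sub_finite_set (finite_setX fN fM) => _ [x _ <-].
    by split; exists x.
  by move=> x y [/lcoset_eqP-/(_ sN) ? /lcoset_eqP-/(_ sM) ?].
- exists (m * k)%N => [|x]; first by rewrite pnatM pm.
  by split; [rewrite expgM|rewrite mulnC expgM]; exact: subgroupX.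
Qed.

End ProPNormal.

(* A copy of [G] carrying the pro-p topology: the neighborhoods of [x] are     *)
(* the sets containing [x * N] for some [N] with [p_normal p N].              *)
Definition pro_p (p : nat) (G : groupType) : Type := G.

Section ProPTopology.
Variables (p : nat) (G : groupType).

HB.instance Definition _ := Group.copy (pro_p p G) G.

Definition pro_p_nbhs (x : pro_p p G) : set_system (pro_p p G) :=
  filter_from [set N | p_normal p N] (left_coset x).

HB.instance Definition _ := hasNbhs.Build (pro_p p G) pro_p_nbhs.

Lemma pro_p_nbhs_filter (x : pro_p p G) : ProperFilter (nbhs x).
Proof.
apply: filter_from_proper; last first.
  move=> N [[/subgroup1 N1 _ _] _]; exists (x * 1); by exists 1.
apply: filter_from_filter; first by exists setT; exact: p_normalT.
move=> N M pN pM; exists (N `&` M); first exact: p_normalI.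
by move=> _ [n [Nn Mn] <-]; split; exists n.
Qed.

Lemma pro_p_nbhs_singleton (x : pro_p p G) A : nbhs x A -> A x.
Proof.
move=> [N [[/subgroup1 N1 _ _] _]]; apply.
by exists 1 => //; rewrite mulg1.
Qed.

Lemma pro_p_nbhs_nbhs (x : pro_p p G) A : nbhs x A -> nbhs x (nbhs^~ A).
Proof.
move=> [N pN xNA]; exists N => // _ [n Nn <-]; exists N => // _ [m Nm <-].
apply: xNA; exists (n * m); last by rewrite mulgA.
by case: pN => -[sN _ _] _; exact: subgroupM.
Qed.

HB.instance Definition _ := Nbhs_isNbhsTopological.Build (pro_p p G)
  pro_p_nbhs_filter pro_p_nbhs_singleton pro_p_nbhs_nbhs.

End ProPTopology.

Definition p_open_subgroup (p : nat) (G : groupType) (U : set G) : Prop :=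
  subgroup U /\ open (U : set (pro_p p G)).

Section POpen.
Variables (p : nat) (G : groupType).
Implicit Types H K N U V W : set G.

Lemma p_openP U : p_open_subgroup p U <->
  subgroup U /\ exists2 N, p_normal p N & N `<=` U.
Proof.
rewrite /p_open_subgroup openE; split=> -[sU]; last first.
  move=> [N pN NU]; split=> // x Ux; exists N => // _ [n /NU Un <-].
  exact: subgroupM.
move=> /(_ 1 (subgroup1 sU))[N pN NU]; split=> //; exists N => // n Nn.
by apply: NU; exists n => //; rewrite mul1g.
Qed.

Lemma p_openT : p_open_subgroup p [set: G].
Proof.
by apply/p_openP; split; [exact: subgroupT|exists setT => //; exact: p_normalT].
Qed.

Lemma p_openI U V : p_open_subgroup p U -> p_open_subgroup p V ->
  p_open_subgroup p (U `&` V).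
Proof.
move=> /p_openP[sU [N pN NU]] /p_openP[sV [M pM MV]].
apply/p_openP; split; first exact: subgroupI.
by exists (N `&` M); [exact: p_normalI|exact: setISS].
Qed.

Lemma p_open_preimage U W (f : G -> G) :
    p_open_subgroup p U -> p_open_subgroup p W ->
    {in U &, {morph f : x y / x * y}} ->
  p_open_subgroup p (U `&` f @^-1` W).
Proof.
move=> /p_openP[sU [N pN NU]] /p_openP[sW [M pM MW]] fM'.
have fM x y : U x -> U y -> f (x * y) = f x * f y.
  by move=> Ux Uy; apply: fM'; exact: mem_set.
have U1 := subgroup1 sU.
have f1 : f 1 = 1 by apply: (mulgI (f 1)); rewrite -fM // !mulg1.
have fV x : U x -> f x^-1 = (f x)^-1.
  move=> Ux; apply: (mulgI (f x)); rewrite -fM ?mulgV //.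
  exact: subgroupV.
have fX x n : U x -> f (x ^+ n) = f x ^+ n.
  move=> Ux; elim: n => [|n IHn]; first by rewrite !expg0.
  by rewrite !expgS fM ?IHn //; exact: subgroupX.
have preS V : subgroup V -> subgroup (U `&` f @^-1` V).
  move=> sV; apply/subgroupP; split.
    by split; rewrite //= f1; exact: subgroup1.
  move=> x y [Ux Vx] [Uy Vy]; have UVy := subgroupV sU Uy.
  split; first exact: subgroupM.
  by rewrite /= fM // fV //; apply: subgroupM => //; exact: subgroupV.
apply/p_openP; split; first exact: preS.
move: pN pM => /p_normalP[[sN _ nN] fN [m pm Nm]].
move=> /p_normalP[[sM _ nM] fiM [k pk Mk]].
pose K := N `&` (U `&` f @^-1` M).
have sK : subgroup K by apply: subgroupI => //; exact: preS.
have fK : finite_set (left_cosets K).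
  pose r (A : set G) := xget 1 A.
  have rN x : N ((r (left_coset x N))^-1 * x).
    have [n Nn e] : left_coset x N (r (left_coset x N)).
      by apply: xgetPex; exists x, 1; rewrite ?mulg1 //; exact: subgroup1.
    by rewrite -[r _]e invgM -mulgA mulVg mulg1; exact: subgroupV.
  pose d x := (r (left_coset x N))^-1 * x.
  pose c x := (left_coset x N, left_coset (f (d x)) M).
  apply: (@finite_lcosets _ _ _ c) => //.
    apply: sub_finite_set (finite_setX fN fiM) => _ [x _ <-].
    by split; [exists x|exists (f (d x))].
  move=> x y [eN /lcoset_eqP-/(_ sM)].
  have dE : (d x)^-1 * d y = x^-1 * y.
    by rewrite /d eN invgM invgK -mulgA mulVKg.
  have Ux := NU _ (rN x); have Uy := NU _ (rN y).
  have Nxy : N (x^-1 * y) by exact/lcoset_eqP.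
  rewrite -fV // -fM //; last exact: subgroupV.
  by rewrite dE => Mxy; split=> //; split=> //; exact: NU.
have [gT [h [hM hE]]] := coset_perm_rep sK fK.
exists [set x | h x = 1]; last first.
  move=> x /= /hE /(_ 1); rewrite conjg1 => -[_ [Ux Mx]].
  by split=> //; exact: MW.
apply/p_normalP; split.
- split=> //; first exact: hom_ker_subgroup.
  by move=> x t /= /hE Kx _; apply/hE => u; rewrite -conjgM.
- by exists #|hom_img h|; exact: hom_ker_index.
- exists (m * k)%N => [|x]; first by rewrite pnatM pm.
  apply/hE => t; rewrite conjXg expgM.
  have Nxt := Nm (x ^ t); have Uxt := NU _ Nxt.
  split; first exact: subgroupX.
  by split; [exact: subgroupX|rewrite /= fX].
Qed.

End POpen.

Section VirtualIsomorphisms.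
Variables (p : nat) (G : groupType).

(* An isomorphism [pdom -> pcod] between p-open subgroups is stored as a      *)
(* function on all of [G]; its values outside [pdom] are irrelevant.          *)
Record p_iso := PIso {
  pdom : set G;
  pcod : set G;
  pfun :> G -> G;
  pdom_open : p_open_subgroup p pdom;
  pcod_open : p_open_subgroup p pcod;
  pfun_bij : set_bij pdom pcod pfun;
  pfunM : {in pdom &, {morph pfun : x y / x * y}} }.

HB.instance Definition _ := gen_eqMixin p_iso.
HB.instance Definition _ := gen_choiceMixin p_iso.

Implicit Types f g h : p_iso.

Lemma pfun_cod f x : pdom f x -> pcod f (f x).
Proof. by case: (pfun_bij f) => fF _ _; exact: fF. Qed.

Lemma pfun_inj f x y : pdom f x -> pdom f y -> f x = f y -> x = y.
Proof.
by case: (pfun_bij f) => _ fI _ dx dy; apply: fI; exact: mem_set.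
Qed.

Lemma pfun_surj f y : pcod f y -> exists2 x, pdom f x & f x = y.
Proof. by case: (pfun_bij f) => _ _ fS /fS. Qed.

Lemma pfunMin f x y : pdom f x -> pdom f y -> f (x * y) = f x * f y.
Proof. by move=> dx dy; apply: pfunM; exact: mem_set. Qed.

Definition p_iso_id : p_iso.
Proof.
refine (@PIso setT setT id (p_openT p G) (p_openT p G) _ _) => //.
by split=> // y _; exists y.
Defined.

Definition pinv_fun f (y : G) : G := xget 1 [set x | pdom f x /\ f x = y].

Lemma pinv_funP f y : pcod f y -> pdom f (pinv_fun f y) /\ f (pinv_fun f y) = y.
Proof.
move=> /pfun_surj[x dx fx].
by apply: (@xgetPex _ 1 [set z | pdom f z /\ f z = y]); exists x.
Qed.

Lemma pinv_funK f x : pdom f x -> pinv_fun f (f x) = x.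
Proof.
move=> dx; have [d' e] := pinv_funP (pfun_cod dx).
exact: pfun_inj d' dx e.
Qed.

Lemma pinv_bij f : set_bij (pcod f) (pdom f) (pinv_fun f).
Proof.
split=> [y /pinv_funP[]//|y z|x dx].
  move=> /set_mem/pinv_funP[_ ey] /set_mem/pinv_funP[_ ez] e.
  by rewrite -ey e ez.
by exists (f x); [exact: pfun_cod|exact: pinv_funK].
Qed.

Lemma pinv_morph f : {in pcod f &, {morph pinv_fun f : x y / x * y}}.
Proof.
move=> y z /set_mem cy /set_mem cz.
have [[dy ey] [dz ez]] := (pinv_funP cy, pinv_funP cz).
rewrite -{1}ey -{1}ez -pfunMin // pinv_funK //.
by case: (pdom_open f) => sd _; exact: subgroupM.
Qed.

Definition p_iso_inv f : p_iso :=
  @PIso (pcod f) (pdom f) (pinv_fun f) (pcod_open f) (pdom_open f)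
    (@pinv_bij f) (@pinv_morph f).

Definition pcomp_dom f g : set G := pdom g `&` g @^-1` (pcod g `&` pdom f).
Definition pcomp_cod f g : set G := f @` (pcod g `&` pdom f).

Lemma pcomp_dom_open f g : p_open_subgroup p (pcomp_dom f g).
Proof.
apply: p_open_preimage; [exact: pdom_open| |exact: pfunM].
by apply: p_openI; [exact: pcod_open|exact: pdom_open].
Qed.

Lemma pcomp_cod_open f g : p_open_subgroup p (pcomp_cod f g).
Proof.
have -> : pcomp_cod f g =
    pdom (p_iso_inv f) `&` p_iso_inv f @^-1` (pcod g `&` pdom f).
  apply/seteqP; split=> [_ [x [cx dx] <-]|y [cy [cy' dy]]].
    split; first exact: pfun_cod.
    by rewrite /= pinv_funK.
  by exists (pinv_fun f y) => //; case: (pinv_funP cy).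
apply: p_open_preimage; [exact: pcod_open| |exact: pinv_morph].
by apply: p_openI; [exact: pcod_open|exact: pdom_open].
Qed.

Lemma pcomp_bij f g : set_bij (pcomp_dom f g) (pcomp_cod f g) (f \o g).
Proof.
split=> [x [dx gx]|x y /set_mem[dx [_ dgx]] /set_mem[dy [_ dgy]]|].
- by exists (g x).
- by move=> /= /(pfun_inj dgx dgy) /(pfun_inj dx dy).
- move=> _ [y [cy dy] <-]; have [x dx gx] := pfun_surj cy.
  by exists x; rewrite /= ?gx //; split; rewrite //= gx.
Qed.

Lemma pcomp_morph f g : {in pcomp_dom f g &, {morph f \o g : x y / x * y}}.
Proof.
move=> x y /set_mem[dx [_ dgx]] /set_mem[dy [_ dgy]].
by rewrite /= !pfunMin.
Qed.

Definition p_iso_comp f g : p_iso :=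
  @PIso (pcomp_dom f g) (pcomp_cod f g) (f \o g) (pcomp_dom_open f g)
    (pcomp_cod_open f g) (@pcomp_bij f g) (@pcomp_morph f g).

Definition p_iso_eq f g : Prop :=
  exists W, [/\ p_open_subgroup p W, W `<=` pdom f `&` pdom g
              & {in W, f =1 g}].

Definition p_iso_eqb f g : bool := `[< p_iso_eq f g >].

Lemma p_iso_eqb_refl : reflexive p_iso_eqb.
Proof.
move=> f; apply/asboolP; exists (pdom f).
by split=> [|x|//]; first exact: pdom_open.
Qed.

Lemma p_iso_eqb_sym : symmetric p_iso_eqb.
Proof.
suff s f g : p_iso_eqb f g -> p_iso_eqb g f
  by move=> f g; apply/idP/idP; apply: s.
move=> /asboolP[W [oW sW fg]]; apply/asboolP; exists W; split=> //.
  by rewrite setIC.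
by move=> x Wx; rewrite fg.
Qed.

Lemma p_iso_eqb_trans : transitive p_iso_eqb.
Proof.
move=> g f h /asboolP[W [oW sW fg]] /asboolP[W' [oW' sW' gh]].
apply/asboolP; exists (W `&` W'); split; first exact: p_openI.
  by move=> x [/sW[? ?] /sW'[? ?]].
by move=> x /set_mem[Wx W'x]; rewrite fg ?gh //; exact: mem_set.
Qed.

Canonical p_iso_equiv := EquivRel p_iso_eqb
  p_iso_eqb_refl p_iso_eqb_sym p_iso_eqb_trans.

End VirtualIsomorphisms.

Definition pcomm (p : nat) (G : groupType) : Type := {eq_quot @p_iso_equiv p G}.

Section Commensurator.
Variables (p : nat) (G : groupType).
Local Notation C := (pcomm p G).
Implicit Types (f g h : p_iso p G) (x y z : C).

HB.instance Definition _ := Choice.on C.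
HB.instance Definition _ := EqQuotient.on C.

(* [pcomm_mul] and [pcomm_inv] pick representatives; [pcomm_mulE] shows that  *)
(* the product of the classes of [f] and [g] is the class of [f \o g].        *)
Definition pcomm_one : C := \pi_C (p_iso_id p G).
Definition pcomm_mul x y : C :=
  \pi_C (p_iso_comp (generic_quotient.repr x) (generic_quotient.repr y)).
Definition pcomm_inv x : C := \pi_C (p_iso_inv (generic_quotient.repr x)).

Lemma pcomm_piP f g : \pi_C f = \pi_C g <-> p_iso_eq f g.
Proof.
split=> [/eqmodP/asboolP//|fg].
by apply/eqmodP/asboolP.
Qed.

Lemma p_iso_comp_eq f f' g g' : p_iso_eq f f' -> p_iso_eq g g' ->
  p_iso_eq (p_iso_comp f g) (p_iso_comp f' g').
Proof.
move=> [W [oW sW ff']] [V [oV sV gg']].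
exists (V `&` (pdom g `&` g @^-1` W)); split.
- apply: p_openI => //; apply: p_open_preimage => //; first exact: pdom_open.
  exact: pfunM.
- move=> x [Vx [dx Wgx]]; have [_ d'x] := sV _ Vx; have [df d'f] := sW _ Wgx.
  have e : g x = g' x by apply: gg'; exact: mem_set.
  split; split=> //; split=> //; try exact: pfun_cod.
  by rewrite -e.
- move=> x /set_mem[Vx [dx Wgx]] /=.
  by rewrite -gg' ?ff' //; exact: mem_set.
Qed.

Lemma pcomm_mulE f g : pcomm_mul (\pi_C f) (\pi_C g) = \pi_C (p_iso_comp f g).
Proof.
by apply/pcomm_piP; apply: p_iso_comp_eq; apply/pcomm_piP; rewrite reprK.
Qed.

Lemma p_iso_eq_on f g : (forall t, pdom f t -> pdom g t /\ f t = g t) ->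
  p_iso_eq f g.
Proof.
move=> fg; exists (pdom f); split; first exact: pdom_open.
  by move=> x dx; case: (fg x dx).
by move=> x /set_mem dx; case: (fg x dx).
Qed.

Lemma pcomm_mulA : associative pcomm_mul.
Proof.
elim/quotW=> f; elim/quotW=> g; elim/quotW=> h.
rewrite (pcomm_mulE g h) (pcomm_mulE f g) !pcomm_mulE.
apply/pcomm_piP; apply: p_iso_eq_on => t /=.
move=> [[dt [ct dyt]] [_ dxt]] /=; split=> //; split=> //.
by split=> //; split=> //; split=> //; exact: pfun_cod.
Qed.

Lemma pcomm_mul1 : left_id pcomm_one pcomm_mul.
Proof.
elim/quotW=> f; rewrite pcomm_mulE.
by apply/pcomm_piP; apply: p_iso_eq_on => t [].
Qed.

Lemma pcomm_mulr1 : right_id pcomm_one pcomm_mul.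
Proof.
elim/quotW=> f; rewrite pcomm_mulE.
by apply/pcomm_piP; apply: p_iso_eq_on => t [_ []].
Qed.

Lemma pcomm_mulV : left_inverse pcomm_one pcomm_inv pcomm_mul.
Proof.
move=> x; rewrite -{2}(reprK x) pcomm_mulE.
apply/pcomm_piP; apply: p_iso_eq_on => t [dt _]; split=> //.
exact: pinv_funK.
Qed.

Lemma pcomm_mulrV : right_inverse pcomm_one pcomm_inv pcomm_mul.
Proof.
move=> x; rewrite -{1}(reprK x) pcomm_mulE.
apply/pcomm_piP; apply: p_iso_eq_on => t [dt _]; split=> //.
by case: (pinv_funP dt).
Qed.

HB.instance Definition _ := isGroup.Build C
  pcomm_mulA pcomm_mul1 pcomm_mulr1 pcomm_mulV pcomm_mulrV.

End Commensurator.

Definition free_on (F : groupType) (I : Type) (x : I -> F) : Prop :=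
  forall (H : groupType) (h : I -> H),
    exists! phi : F -> H,
      {morph phi : u v / u * v} /\ forall i, phi (x i) = h i.

Definition free_of_finite_rank (F : groupType) : Prop :=
  exists n (x : 'I_n -> F), free_on x.

Definition nonabelian_group (F : groupType) : Prop :=
  exists u v : F, ~ commute u v.

(* Main.v *)
Require Import Defs.
From HB Require Import structures.
From mathcomp Require Import all_boot all_fingroup all_solvable.
From mathcomp Require Import zmodp.
From mathcomp Require Import boolp classical_sets functions cardinality.
From mathcomp Require Import zify.

Set Implicit Arguments.
Unset Strict Implicit.
Unset Printing Implicit Defensive.

Local Open Scope classical_set_scope.
Local Open Scope card_scope.

(** Write [C] for the p-commensurator of [F].  By Schreier, every p-open subgroup
    [W] of [F] is free; an element of [C] defined on [W] is determined by the
    image of a basis of [W], and any two p-open bases of the same size are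
    carried to each other by exactly one element of [C] ([carries]).  All
    operations on bases are substitutions of words, hence commute with [C].
    There are two kinds.

    - Nielsen moves ([tequiv], [nequiv]).  A transvection multiplies an entry by
      another one, an inversion inverts one.  Nielsen's theorem ([nielsen]) says
      that any two bases of the same free group are related by them.

    - Coverings ([cover]).  From a basis [x, y, z, ...] one obtains the Schreier
      basis [x ^ p, x ^ i y x ^ -i, x ^ i z x ^ -i, ...] of a normal subgroup of
      index [p].

    Fix a cover [bstar] of a basis of [F]; its rank is at least three.  A p-open
    subgroup of the span of [bstar] is reached by a chain of subgroups, each
    normal of index [p] in the previous one, since finite p-groups have such
    chains.  So its bases are obtained from [bstar] by moves and coverings
    ([reach_basis]).  The level of a basis is the number of coverings; the rank
    determines it.

    The simple group is the subgroup [elem] generated by the transvections of all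
    these bases.  Comparing two bases of the same level step by step
    shows that [C] is generated by transvections and inversions.  Any two
    inversions of a basis are congruent modulo transvections, and an inversion
    becomes a product of [p] inversions in a cover.  For odd [p] all inversions
    of all levels are therefore congruent modulo [elem]; for [p = 2] they lie in
    [elem].  Hence the index of [elem] is at most two ([elem_index]).

    For simplicity, let [N] be a nontrivial normal subgroup of [elem].  The
    commutator of an element [f] of [N] with the conjugation by [u] is the
    conjugation by [f u * u^-1], so that [N] contains the conjugation by some
    nontrivial word [w].  Passing to covers shortens [w] as long as all its
    exponent sums are divisible by [p] ([unbalanced_ex]); the commutator with a
    transvection then leaves one exponent sum, which is prime to [p], and further
    covers remove one letter [s] from [w] altogether ([level_ex]).  In one more
    cover, conjugation by [w] carries a transvection of a lift of [s] to the
    transvection of another lift, and a double commutator gives a transvection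
    in [N] ([level_core]).  The transvections of one level are conjugate under
    [elem] ([level_one]), those of a basis are products of transvections of its
    cover ([level_down]), and the argument of [level_core] leads from one level
    to the next ([level_up]).  Hence [N] contains all transvections. *)

(** * Words, substitutions and free tuples *)

Section Words.
Local Open Scope group_scope.
Variable I : Type.

(** The letter [(i, e)] stands for the [i]-th generator, inverted if [e]. *)
Definition letter : Type := I * bool.
Definition word : Type := seq letter.

Definition linv (l : letter) : letter := (l.1, ~~ l.2).
Definition winv (L : word) : word := rev (map linv L).

Lemma linvK : involutive linv.
Proof. by case=> i e; rewrite /linv /= negbK. Qed.

Lemma winvK : involutive winv.
Proof.
by move=> L; rewrite /winv map_rev revK -map_comp (eq_map linvK) map_id.
Qed.

Lemma winv_cat L L' : winv (L ++ L') = winv L' ++ winv L.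
Proof. by rewrite /winv map_cat rev_cat. Qed.

Lemma size_winv L : size (winv L) = size L.
Proof. by rewrite /winv size_rev size_map. Qed.

Section Eval.
Variable G : groupType.
Implicit Type b : I -> G.

Definition lev b (l : letter) : G := if l.2 then (b l.1)^-1 else b l.1.
Definition ev b (L : word) : G := foldr (fun l g => lev b l * g) 1 L.

Lemma ev_cat b L L' : ev b (L ++ L') = ev b L * ev b L'.
Proof. by elim: L => [|l L IH] /=; rewrite ?mul1g // IH mulgA. Qed.

Lemma ev1 b l : ev b [:: l] = lev b l.
Proof. by rewrite /= mulg1. Qed.

Lemma ev_cons b l L : ev b (l :: L) = lev b l * ev b L.
Proof. by []. Qed.

Lemma ev_rcons b l L : ev b (rcons L l) = ev b L * lev b l.
Proof. by rewrite -cats1 ev_cat ev1. Qed.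

Lemma lev_linv b l : lev b (linv l) = (lev b l)^-1.
Proof. by case: l => i [] //=; rewrite /lev /= invgK. Qed.

Lemma ev_winv b L : ev b (winv L) = (ev b L)^-1.
Proof.
elim: L => [|l L IH]; first by rewrite invg1.
by rewrite -cat1s winv_cat !ev_cat IH invgM !ev1 /= lev_linv.
Qed.

Lemma ev_nseq b i e n : ev b (nseq n (i, e)) = lev b (i, e) ^+ n.
Proof. by elim: n => [|n IH] //=; rewrite IH expgS. Qed.

Definition span b : set G := [set g | exists L, ev b L = g].

Lemma span_ev b L : span b (ev b L). Proof. by exists L. Qed.

Lemma span_gen b i : span b (b i).
Proof. by exists [:: (i, false)]; rewrite ev1. Qed.

Lemma span_subgroup b : subgroup (span b).
Proof.
apply/subgroupP; split; first by exists [::].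
by move=> _ _ [L <-] [L' <-]; exists (L ++ winv L'); rewrite ev_cat ev_winv.
Qed.

Lemma span_min b (H : set G) :
  subgroup H -> (forall i, H (b i)) -> span b `<=` H.
Proof.
move=> sH Hb _ [L <-]; elim: L => [|[i e] L IH]; first exact: subgroup1.
rewrite ev_cons; apply: subgroupM => //.
by case: e; rewrite /lev //=; apply: subgroupV.
Qed.

End Eval.

(** Freeness is stated as a property of relations: a word that is trivial in
    [b] is trivial in every tuple of every group.  This is equivalent to the
    universal property of the subgroup [span b], but mentions neither this
    subgroup as a group of its own nor partially defined homomorphisms. *)
Definition free_tuple (G : groupType) (b : I -> G) : Prop :=
  forall (H : groupType) (h : I -> H) L, ev b L = 1 -> ev h L = 1.

Lemma free_tuple_eq (G : groupType) (b : I -> G) (H : groupType) (h : I -> H) L L' :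
  free_tuple b -> ev b L = ev b L' -> ev h L = ev h L'.
Proof.
move=> fb e; apply: divg1_eq.
by rewrite -ev_winv -ev_cat; apply: fb; rewrite ev_cat ev_winv e mulgV.
Qed.

End Words.

Section Substitution.
Local Open Scope group_scope.
Variables I J : Type.
Implicit Type s : J -> word I.

(** A substitution turns [I]-tuples into [J]-tuples in every group at once.
    All operations on bases below are substitutions, so that they commute
    with homomorphisms. *)
Definition sub s (G : groupType) (b : I -> G) : J -> G := fun j => ev b (s j).

Definition wsub s (L : word J) : word I :=
  flatten [seq (if l.2 then winv (s l.1) else s l.1) | l <- L].

Lemma ev_sub s (G : groupType) (b : I -> G) L : ev (sub s b) L = ev b (wsub s L).
Proof.
elim: L => [|[j e] L IH] //; rewrite ev_cons IH /wsub /= ev_cat; congr (_ * _).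
by case: e => //=; rewrite ev_winv.
Qed.

Lemma span_sub s (G : groupType) (b : I -> G) : span (sub s b) `<=` span b.
Proof. by move=> _ [L <-]; rewrite ev_sub; exact: span_ev. Qed.

End Substitution.

Lemma span_trans I J (G : groupType) (b : I -> G) (c : J -> G) :
  (forall i, span c (b i)) -> span b `<=` span c.
Proof. by move=> h; apply: span_min => //; exact: span_subgroup. Qed.

(** Isomorphisms between subgroups are stored as total functions, so that their
    compatibility with words refers to a subgroup [W] that contains the tuple. *)
Lemma morph_ev I (G H : groupType) (W : set G) (f : G -> H) (b : I -> G) L :
    subgroup W -> (forall x y, W x -> W y -> f (x * y)%g = (f x * f y)%g) ->
    (forall i, W (b i)) -> f (ev b L) = ev (f \o b) L.
Proof.
move=> sW fM Wb; have W1 := subgroup1 sW.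
have f1 : f 1%g = 1%g by apply: (mulgI (f 1%g)); rewrite -fM // !mulg1.
have fV x : W x -> f x^-1%g = (f x)^-1%g.
  by move=> Wx; apply: (mulgI (f x)); rewrite -fM ?mulgV //; exact: subgroupV.
elim: L => [|[i e] L IH] //; rewrite !ev_cons fM; last 1 first.
- by apply: (span_min sW Wb); exact: span_ev.
- by rewrite IH; case: e; rewrite /lev //= fV.
- by case: e; rewrite /lev //=; exact: subgroupV.
Qed.

(** * The group of bijections of a type *)

Section Sym.
Variable T : Type.

Record sym := Sym { sfun :> T -> T; sinv : T -> T;
  sfunK : cancel sfun sinv; sinvK : cancel sinv sfun }.

HB.instance Definition _ := gen_eqMixin sym.
HB.instance Definition _ := gen_choiceMixin sym.

Lemma sym_eq (u v : sym) : sfun u =1 sfun v -> u = v.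
Proof.
case: u v => f g fK gK [f' g' fK' gK'] /= e.
have ef : f = f' by apply/funext.
subst f'; have eg : g = g' by apply/funext => x; rewrite -{1}(gK' x) fK.
by subst g'; congr Sym; exact: Prop_irrelevance.
Qed.

Definition sym1 : sym := @Sym id id (fun=> erefl) (fun=> erefl).
Definition symM (u v : sym) : sym :=
  @Sym (sfun u \o sfun v) (sinv v \o sinv u) (can_comp (@sfunK u) (@sfunK v))
       (can_comp (@sinvK v) (@sinvK u)).
Definition symV (u : sym) : sym := @Sym (sinv u) (sfun u) (@sinvK u) (@sfunK u).

Lemma symMA : associative symM. Proof. by move=> u v w; exact: sym_eq. Qed.
Lemma sym1M : left_id sym1 symM. Proof. by move=> u; exact: sym_eq. Qed.
Lemma symM1 : right_id sym1 symM. Proof. by move=> u; exact: sym_eq. Qed.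
Lemma symVM : left_inverse sym1 symV symM.
Proof. by move=> u; apply: sym_eq => x /=; rewrite sfunK. Qed.
Lemma symMV : right_inverse sym1 symV symM.
Proof. by move=> u; apply: sym_eq => x /=; rewrite sinvK. Qed.

HB.instance Definition _ := isGroup.Build sym symMA sym1M symM1 symVM symMV.

End Sym.

(** * Nielsen moves *)

Section Moves.
Local Open Scope group_scope.
Variable I : finType.

Definition rsub i (l : letter I) (k : I) : word I :=
  if k == i then [:: (k, false); l] else [:: (k, false)].
Definition lsub i (l : letter I) (k : I) : word I :=
  if k == i then [:: l; (k, false)] else [:: (k, false)].
Definition isub i (k : I) : word I := [:: (k, k == i)].

Definition rmul i l (G : groupType) (b : I -> G) : I -> G := sub (rsub i l) b.
Definition lmul i l (G : groupType) (b : I -> G) : I -> G := sub (lsub i l) b.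
Definition invat i (G : groupType) (b : I -> G) : I -> G := sub (isub i) b.

Section InGroup.
Variable G : groupType.
Implicit Types (b c : I -> G) (i j k : I) (l : letter I).

Lemma rmulE i l b k : rmul i l b k = if k == i then b k * lev b l else b k.
Proof. by rewrite /rmul /sub /rsub; case: eqP => [->|_]; rewrite /= !mulg1. Qed.

Lemma lmulE i l b k : lmul i l b k = if k == i then lev b l * b k else b k.
Proof. by rewrite /lmul /sub /lsub; case: eqP => [->|_]; rewrite /= !mulg1. Qed.

Lemma invatE i b k : invat i b k = if k == i then (b k)^-1 else b k.
Proof. by rewrite /invat /sub /isub ev1 /lev /=; case: eqP. Qed.

Lemma lev_rmul i l' b l : l.1 != i -> lev (rmul i l' b) l = lev b l.
Proof. by move=> /negPf li; rewrite /lev !rmulE li. Qed.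

Lemma lev_lmul i l' b l : l.1 != i -> lev (lmul i l' b) l = lev b l.
Proof. by move=> /negPf li; rewrite /lev !lmulE li. Qed.

Lemma lev_invat i b l : l.1 != i -> lev (invat i b) l = lev b l.
Proof. by move=> /negPf li; rewrite /lev !invatE li. Qed.

Lemma rmulK i l b : l.1 != i -> rmul i (linv l) (rmul i l b) = b.
Proof.
move=> li; apply/funext => k; rewrite !rmulE lev_rmul // lev_linv.
by case: eqP => // _; rewrite mulgK.
Qed.

Lemma lmulK i l b : l.1 != i -> lmul i (linv l) (lmul i l b) = b.
Proof.
move=> li; apply/funext => k; rewrite !lmulE lev_lmul // lev_linv.
by case: eqP => // _; rewrite mulKg.
Qed.

Lemma invatK i b : invat i (invat i b) = b.
Proof. by apply/funext => k; rewrite !invatE; case: eqP => // _; rewrite invgK. Qed.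

Lemma invatC i j b : invat i (invat j b) = invat j (invat i b).
Proof. by apply/funext => k; rewrite !invatE; do 2 case: eqP => //. Qed.

Lemma invat_lmul i l b : l.1 != i -> invat i (lmul i l b) = rmul i (linv l) (invat i b).
Proof.
move=> li; apply/funext => j; rewrite invatE rmulE lev_invat // lev_linv.
by rewrite lmulE invatE; case: eqP => // _; rewrite invgM.
Qed.

Lemma rmulC i i' l l' b : i != i' -> l.1 != i' -> l'.1 != i ->
  rmul i l (rmul i' l' b) = rmul i' l' (rmul i l b).
Proof.
move=> ii li li'; apply/funext => k; rewrite !rmulE lev_rmul // (lev_rmul l b li').
by case: (eqVneq k i) => [->|//]; rewrite (negPf ii).
Qed.

Lemma rmul_invat z i l b : z != i -> z != l.1 ->
  rmul i l (invat z b) = invat z (rmul i l b).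
Proof.
move=> zi zl; apply/funext => k; rewrite !rmulE !invatE rmulE lev_invat 1?eq_sym //.
by case: (eqVneq k i) => [->|//]; rewrite eq_sym (negPf zi).
Qed.

Lemma rmul_commutator i j k b : i != j -> k != i -> k != j ->
  rmul i (j, false) (rmul j (k, true) (rmul i (j, true) (rmul j (k, false) b)))
    = rmul i (k, true) b.
Proof.
move=> ij ki kj; have ji : j != i by rewrite eq_sym.
have levT c x : lev c (x, true) = (c x)^-1 by [].
have levF c x : lev c (x, false) = c x by [].
have E := (rmulE, levT, levF, eqxx, negPf ij, negPf ji, negPf ki, negPf kj).
apply/funext => x; rewrite !E.
have [->|xi] := eqVneq x i; rewrite ?E.
  by rewrite mulgK invgM -!mulgA mulVg mulg1.
by case: (eqVneq x j) => [->|//]; rewrite ?E mulgK.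
Qed.

Inductive tequiv b : (I -> G) -> Prop :=
| tequiv_refl : tequiv b b
| tequiv_rmul c i l : tequiv b c -> l.1 != i -> tequiv b (rmul i l c)
| tequiv_lmul c i l : tequiv b c -> l.1 != i -> tequiv b (lmul i l c).

Lemma tequiv_trans b c d : tequiv b c -> tequiv c d -> tequiv b d.
Proof.
move=> bc; elim=> // d' i l _ bd' li; [exact: tequiv_rmul|exact: tequiv_lmul].
Qed.

Lemma tequiv_sym b c : tequiv b c -> tequiv c b.
Proof.
elim=> [|d i l _ db li|d i l _ db li]; first exact: tequiv_refl.
- apply: tequiv_trans db; rewrite -{2}(rmulK d li).
  by apply: tequiv_rmul; [exact: tequiv_refl|].
- apply: tequiv_trans db; rewrite -{2}(lmulK d li).
  by apply: tequiv_lmul; [exact: tequiv_refl|].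
Qed.

Lemma tequiv_invat k b c : tequiv b c -> tequiv (invat k b) (invat k c).
Proof.
elim=> [|d i l _ bd li|d i l _ bd li]; first exact: tequiv_refl.
- have [ik|ik] := eqVneq i k.
    have -> : invat k (rmul i l d) = lmul i (linv l) (invat k d).
      subst k; apply/funext => j; rewrite invatE lmulE lev_invat // lev_linv.
      by rewrite rmulE invatE; case: eqP => // _; rewrite invgM.
    exact: tequiv_lmul.
  have -> : invat k (rmul i l d) = rmul i (if l.1 == k then linv l else l) (invat k d).
    apply/funext => j; rewrite invatE !rmulE invatE.
    case: (eqVneq j i) => [->|//]; rewrite (negPf ik); congr (_ * _).
    case: (eqVneq l.1 k) => [e|lk]; last by rewrite lev_invat.
    by rewrite lev_linv /lev invatE e eqxx; case: l.2; rewrite ?invgK.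
  by apply: tequiv_rmul => //; case: (l.1 == k).
- have [ik|ik] := eqVneq i k.
    by subst k; rewrite invat_lmul //; exact: tequiv_rmul.
  have -> : invat k (lmul i l d) = lmul i (if l.1 == k then linv l else l) (invat k d).
    apply/funext => j; rewrite invatE !lmulE invatE.
    case: (eqVneq j i) => [->|//]; rewrite (negPf ik); congr (_ * _).
    case: (eqVneq l.1 k) => [e|lk]; last by rewrite lev_invat.
    by rewrite lev_linv /lev invatE e eqxx; case: l.2; rewrite ?invgK.
  by apply: tequiv_lmul => //; case: (l.1 == k).
Qed.

(** [(x, y)] becomes [(y^-1 * x, y)], then [(y^-1 * x, x)], then [(y^-1, x)]. *)
Lemma tequiv_tperm i j b : i != j -> tequiv b (invat i (b \o tperm i j)).
Proof.
move=> ij; have ji : j != i by rewrite eq_sym.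
have -> : invat i (b \o tperm i j)
    = rmul i (j, true) (rmul j (i, false) (lmul i (j, true) b)).
  have E := (rmulE, lmulE, eqxx, negPf ij, negPf ji).
  apply/funext => k; rewrite invatE /= !E /lev /= !E /lev /= !E.
  case: tpermP => [->|->|/eqP/negPf ki /eqP/negPf kj]; rewrite ?E ?ki ?kj //.
    by rewrite /= mulVKg mulgK.
  by rewrite /= mulVKg.
by do 2![apply: tequiv_rmul => //]; apply: tequiv_lmul => //; exact: tequiv_refl.
Qed.

Lemma tequiv_invat2 i j b : i != j -> tequiv b (invat i (invat j b)).
Proof.
move=> ij; have ji : j != i by rewrite eq_sym.
apply: (tequiv_trans (tequiv_tperm b ij)).
have -> : invat i (invat j b)
    = invat i ((invat i (b \o tperm i j)) \o tperm i j).
  have E := (eqxx, negPf ij, negPf ji).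
  apply/funext => k; rewrite !invatE /= !invatE /= tpermK.
  by case: tpermP => [->|->|/eqP/negPf ki /eqP/negPf kj]; rewrite ?E ?ki ?kj.
exact: tequiv_tperm.
Qed.

Lemma tequiv_invatC i j b : tequiv (invat i b) (invat j b).
Proof.
have [->|ij] := eqVneq i j; first exact: tequiv_refl.
have -> : invat j b = invat i (invat j (invat i b)) by rewrite (invatC j) invatK.
exact: tequiv_invat2.
Qed.

(** Inversions of different entries are equivalent and cancel in pairs, so that
    only their number modulo 2 matters. *)
Lemma tequiv_invats s k b :
  tequiv (foldr (fun i c => invat i c) b s) (if odd (size s) then invat k b else b).
Proof.
elim: s => [|i s IH] /=; first exact: tequiv_refl.
apply: (tequiv_trans (tequiv_invat i IH)); case: (odd _) => /=.
  apply: (tequiv_trans (tequiv_invatC i k _)).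
  by rewrite invatK; exact: tequiv_refl.
exact: tequiv_invatC.
Qed.

Definition upd b k g : I -> G := fun j => if j == k then g else b j.

Lemma tequiv_updr b k L : all (fun l => l.1 != k) L ->
  tequiv b (upd b k (b k * ev b L)).
Proof.
elim/last_ind: L => [_|L l IH]; first rewrite mulg1.
  have -> : upd b k (b k) = b by apply/funext => j; rewrite /upd; case: eqP => // ->.
  exact: tequiv_refl.
rewrite all_rcons => /andP[lk /IH bc].
have -> : upd b k (b k * ev b (rcons L l)) = rmul k l (upd b k (b k * ev b L)).
  apply/funext => j; rewrite rmulE /upd; case: eqP => // _.
  by rewrite ev_rcons /lev (negPf lk) !mulgA.
exact: tequiv_rmul.
Qed.

Lemma tequiv_updl b k L : all (fun l => l.1 != k) L ->
  tequiv b (upd b k (ev b L * b k)).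
Proof.
elim: L => [_|l L IH]; first rewrite mul1g.
  have -> : upd b k (b k) = b by apply/funext => j; rewrite /upd; case: eqP => // ->.
  exact: tequiv_refl.
rewrite [all _ _]/= => /andP[lk /IH bc].
have -> : upd b k (ev b (l :: L) * b k) = lmul k l (upd b k (ev b L * b k)).
  apply/funext => j; rewrite lmulE /upd; case: eqP => // _.
  by rewrite ev_cons /lev (negPf lk) !mulgA.
exact: tequiv_lmul.
Qed.

Lemma ev_eq_in b c (A : pred I) L : all (fun l => A l.1) L ->
  (forall k, A k -> b k = c k) -> ev b L = ev c L.
Proof.
move=> + bc; elim: L => [|l L IH] //= /andP[Al /IH->].
by rewrite /lev bc.
Qed.

(** The entries indexed by [A] can be changed one at a time, since the factors
    only involve entries outside [A], which keep their values throughout. *)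
Lemma tequiv_block (A : pred I) b c :
    (forall k, ~~ A k -> c k = b k) ->
    (forall k, A k -> exists L L', [/\ all (fun l => ~~ A l.1) L,
       all (fun l => ~~ A l.1) L' & c k = ev b L * b k * ev b L']) ->
  tequiv b c.
Proof.
move=> cbA cA.
have H (s : seq I) : tequiv b (fun k => if k \in s then c k else b k).
  elim: s => [|k s IH]; first exact: tequiv_refl.
  set d := (X in tequiv b X) in IH.
  have [ks|ks] := boolP (k \in s).
    have -> : (fun j => if j \in k :: s then c j else b j) = d.
      by apply/funext => j; rewrite /d inE; case: eqP => // ->; rewrite ks.
    exact: IH.
  have -> : (fun j => if j \in k :: s then c j else b j) = upd d k (c k).
    by apply/funext => j; rewrite /d /upd inE; case: eqP => // ->.
  have [Ak|Ak] := boolP (A k); last first.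
    have -> : upd d k (c k) = d; last exact: IH.
    by apply/funext => j; rewrite /upd /d; case: eqP => // ->; rewrite (negPf ks) cbA.
  have [L [L' [LA LA' ->]]] := cA k Ak.
  have db j : ~~ A j -> b j = d j by move=> Aj; rewrite /d; case: ifP => // _; rewrite cbA.
  have nk L0 : all (fun l => ~~ A l.1) L0 -> all (fun l => l.1 != k) L0.
    by apply: sub_all => l; apply: contra => /eqP->.
  apply: (tequiv_trans IH); apply: (tequiv_trans (tequiv_updr d (nk _ LA'))).
  set d' := upd d k _.
  have -> : upd d k (ev b L * b k * ev b L') = upd d' k (ev d' L * d' k).
    apply/funext => j; rewrite /upd; case: eqP => // jk; last first.
      by rewrite /d' /upd; case: eqP.
    rewrite /d' /upd eqxx -mulgA; congr (_ * (_ * _)).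
    - apply: (@ev_eq_in _ _ (predC A)) LA _ => i Ai; case: eqP => [ik|_]; last exact: db.
      by rewrite /= ik Ak in Ai.
    - by rewrite /d (negPf ks).
    - exact: (@ev_eq_in _ _ (predC A)) LA' db.
  exact/tequiv_updl/nk.
have := H (enum I); congr tequiv.
by apply/funext => k; rewrite mem_enum.
Qed.

Lemma tequiv_span b c : tequiv b c -> span b = span c.
Proof.
have step b' c' : tequiv b' c' -> span c' `<=` span b'.
  elim=> [|d i l _ IH li|d i l _ IH li] //;
  apply: (subset_trans _ IH); exact: span_sub.
by move=> bc; apply/seteqP; split; apply: step => //; exact: tequiv_sym.
Qed.

Lemma free_sub (J : Type) (s : J -> word I) b : free_tuple b ->
    (forall (H : groupType) (h : J -> H), exists h', sub s h' = h) ->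
  free_tuple (sub s b).
Proof.
move=> fb sK H h L; rewrite ev_sub => bL; have [h' <-] := sK H h.
by rewrite ev_sub; exact: fb.
Qed.

End InGroup.

Lemma free_invat (G : groupType) i (b : I -> G) : free_tuple b -> free_tuple (invat i b).
Proof.
by move=> fb; apply: free_sub => // H h; exists (invat i h); exact: invatK.
Qed.

Lemma free_tequiv (G : groupType) (b c : I -> G) : tequiv b c -> free_tuple b -> free_tuple c.
Proof.
move=> bc fb; elim: bc => // d i l _ fd li; apply: free_sub => // H h.
- exists (rmul i (linv l) h); rewrite -/(rmul i l _) -{1}(linvK l).
  exact: rmulK.
- exists (lmul i (linv l) h); rewrite -/(lmul i l _) -{1}(linvK l).
  exact: lmulK.
Qed.

(** Once recorded as a substitution, a sequence of moves can be replayed on any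
    other tuple, for instance on the image of [b] under an isomorphism. *)
Lemma tequiv_subst (G : groupType) (b c : I -> G) : tequiv b c ->
  exists s : I -> word I, c = sub s b /\
    forall (H : groupType) (h : I -> H), tequiv h (sub s h).
Proof.
have comp (H : groupType) (h : I -> H) s t :
    sub s (sub t h) = sub (fun k => wsub t (s k)) h.
  by apply/funext => k; rewrite /sub ev_sub.
elim=> [|d i l _ [s [-> sH]] li|d i l _ [s [-> sH]] li].
- exists (fun k => [:: (k, false)]).
  have e (H : groupType) (h : I -> H) : sub (fun k => [:: (k, false)]) h = h.
    by apply/funext => k; rewrite /sub ev1.
  by split=> [|H h]; rewrite e //; exact: tequiv_refl.
- exists (fun k => wsub s (rsub i l k)); rewrite -comp; split=> // H h.
  by rewrite -comp; apply: tequiv_rmul.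
- exists (fun k => wsub s (lsub i l k)); rewrite -comp; split=> // H h.
  by rewrite -comp; apply: tequiv_lmul.
Qed.

(** One optional inversion is enough to account for all permutations and
    inversions of the entries, by [tequiv_tperm] and [tequiv_invatC]. *)
Definition nequiv (G : groupType) (b c : I -> G) : Prop :=
  tequiv b c \/ exists k, tequiv b (invat k c).

Section NielsenEquiv.
Variable G : groupType.
Implicit Types b c : I -> G.

Lemma nequiv_refl b : nequiv b b.
Proof. by left; exact: tequiv_refl. Qed.

Lemma nequiv_invat i b : nequiv b (invat i b).
Proof. by right; exists i; rewrite invatK; exact: tequiv_refl. Qed.

Lemma nequiv_sym b c : nequiv b c -> nequiv c b.
Proof.
case=> [bc|[k bc]]; first by left; exact: tequiv_sym.
by right; exists k; rewrite -(invatK k c); apply: tequiv_invat; exact: tequiv_sym.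
Qed.

Lemma nequiv_trans b c d : nequiv b c -> nequiv c d -> nequiv b d.
Proof.
case=> [bc|[k bc]] [cd|[j cd]].
- by left; exact: tequiv_trans cd.
- by right; exists j; exact: tequiv_trans cd.
- by right; exists k; apply: (tequiv_trans bc); exact: tequiv_invat.
- left; apply: (tequiv_trans bc); rewrite -(invatK k d).
  apply: tequiv_invat; apply: (tequiv_trans cd); exact: tequiv_invatC.
Qed.

Lemma nequiv_tperm i j b : nequiv b (b \o tperm i j).
Proof.
have [->|ij] := eqVneq i j.
  have -> : b \o tperm j j = b by apply/funext => k /=; rewrite tperm1 perm1.
  exact: nequiv_refl.
by right; exists i; exact: tequiv_tperm.
Qed.

Lemma nequiv_perm (s : {perm I}) b : nequiv b (b \o s).
Proof.
have [ts -> _] := prod_tpermP s.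
elim: ts b => [|t ts IH] b.
  rewrite big_nil; have -> : b \o (1 : {perm I}) = b by apply/funext => k /=; rewrite perm1.
  exact: nequiv_refl.
rewrite big_cons.
have -> : b \o (tperm t.1 t.2 * \prod_(i <- ts) tperm i.1 i.2)%g
   = (b \o (\prod_(i <- ts) tperm i.1 i.2)%g) \o tperm t.1 t.2.
  by apply/funext => k; rewrite /= permM.
exact: nequiv_trans (IH b) (nequiv_tperm _ _ _).
Qed.

Lemma nequiv_span b c : nequiv b c -> span b = span c.
Proof.
case=> [/tequiv_span//|[k /tequiv_span->]].
apply/seteqP; split; first exact: span_sub.
by rewrite -{1}(invatK k c); exact: span_sub.
Qed.

Lemma nequiv_free b c : nequiv b c -> free_tuple b -> free_tuple c.
Proof.
case=> [/free_tequiv//|[k /free_tequiv h] /h fc].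
by rewrite -(invatK k c); exact: free_invat.
Qed.

End NielsenEquiv.
End Moves.

(** * Normal forms *)

Section Reduced.
Variable I : finType.
Implicit Types (l : letter I) (L u v : word I).

Definition reduced L : bool := sorted (fun x y : letter I => y != linv x) L.

Definition consr l L : word I :=
  if L is l' :: L' then if l' == linv l then L' else l :: L else [:: l].
Definition red L : word I := foldr consr [::] L.

Lemma consr_reduced l L : reduced L -> reduced (consr l L).
Proof.
case: L => [|l' L] //= rL; case: ifP => [_|/negbT e]; last by rewrite /= e.
exact: path_sorted rL.
Qed.

Lemma red_reduced L : reduced (red L).
Proof. by elim: L => //= l L; exact: consr_reduced. Qed.

Lemma red_id L : reduced L -> red L = L.
Proof.
elim: L => [|l L IH] //= rL; rewrite IH; last exact: path_sorted rL.
by case: L rL {IH} => [|l' L] //= /andP[/negPf->].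
Qed.

Lemma size_red L : size (red L) <= size L.
Proof.
elim: L => [|l L IH] //=; case: (red L) IH => [|m L'] //= IH.
by case: ifP => _ //=; rewrite ltnW // ltnS ltnW.
Qed.

Lemma red_size L : size (red L) = size L -> red L = L.
Proof.
elim: L => [|l L IH] //= s; have le := size_red L.
case e : (red L) s le => [|m L'] /=; first by move=> [/esym/size0nil->].
case: ifP => _ /=; first by move=> ->; rewrite ltnNge leqnSn.
by move=> [s] _; congr cons; rewrite -e; apply: IH; rewrite e.
Qed.

Lemma consrK l L : reduced L -> consr (linv l) (consr l L) = L.
Proof.
case: L => [|l' L] /=; first by rewrite linvK eqxx.
case: eqP => [->|_] /=; last by rewrite linvK eqxx.
by case: L => [|l'' L] //= /andP[/negPf->].
Qed.

Lemma ev_red (G : groupType) (b : I -> G) L : ev b (red L) = ev b L.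
Proof.
elim: L => [|l L IH] //=; rewrite -IH; case: (red L) => [|l' L'] //=.
by case: eqP => [->|] //=; rewrite lev_linv mulVKg.
Qed.

Definition rword := {L : word I | reduced L}.

Definition rcons_act l (x : rword) : rword :=
  exist _ (consr l (sval x)) (consr_reduced l (svalP x)).

Lemma rcons_actK l : cancel (rcons_act l) (rcons_act (linv l)).
Proof. by case=> L rL; apply: eq_exist; rewrite /= consrK. Qed.

Definition rword_sym (i : I) : sym rword :=
  Sym (rcons_actK (i, false)) (rcons_actK (i, true)).

Lemma rword_symE L : sval (ev rword_sym L (exist _ [::] isT)) = red L.
Proof.
elim: L => [|[i e] L IH] //; rewrite ev_cons /= -IH.
by case: e.
Qed.

(** The free group acts on reduced words by left multiplication, whence the
    uniqueness of normal forms. *)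
Lemma red_ext L L' :
  (forall (H : groupType) (h : I -> H), ev h L = ev h L') -> red L = red L'.
Proof. by move=> e; rewrite -!rword_symE e. Qed.

Lemma red_eq (G : groupType) (b : I -> G) L L' :
  free_tuple b -> ev b L = ev b L' -> red L = red L'.
Proof. by move=> fb e; apply: red_ext => H h; exact: free_tuple_eq e. Qed.

Fixpoint lcp u v : nat :=
  match u, v with x :: u', y :: v' => if x == y then (lcp u' v').+1 else 0 | _, _ => 0 end.

Definition hd_neq u v : bool :=
  match u, v with x :: _, y :: _ => x != y | _, _ => true end.

Lemma lcp_split u v :
  exists p a c, [/\ u = p ++ a, v = p ++ c, size p = lcp u v & hd_neq a c].
Proof.
elim: u v => [|x u IH] [|y v]; try by [exists [::], [::], [::]|
  exists [::], [::], (y :: v)|exists [::], (x :: u), [::]].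
rewrite /=; case: eqP => [<-|/eqP xy]; last by exists [::], (x :: u), (y :: v).
have [p [a [c [-> -> s h]]]] := IH v.
by exists (x :: p), a, c; rewrite /= s.
Qed.

Lemma lcpC u v : lcp u v = lcp v u.
Proof. by elim: u v => [|x u IH] [|y v] //=; rewrite eq_sym IH. Qed.

Lemma lcp_ultra u v w : minn (lcp u v) (lcp v w) <= lcp u w.
Proof.
elim: u v w => [|x u IH] [|y v] [|z w] //=; rewrite ?minn0 ?min0n //.
case: (x =P y) => [->|_]; last by rewrite min0n.
by case: (y =P z) => _; rewrite ?minn0 // minnSS ltnS.
Qed.

Lemma lcpxx u : lcp u u = size u.
Proof. by elim: u => //= x u ->; rewrite eqxx. Qed.

Lemma reduced_catr u v : reduced (u ++ v) -> reduced v.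
Proof. by elim: u => //= x u IH /path_sorted /IH. Qed.

Lemma reduced_winv_cat u v :
  reduced u -> reduced v -> hd_neq u v -> reduced (winv u ++ v).
Proof.
elim: u v => [|x u IH] v //= ru rv h.
rewrite /winv /= rev_cons cat_rcons; apply: IH.
- exact: path_sorted ru.
- by case: v rv h => //= y v ->; rewrite linvK eq_sym => ->.
- by case: u ru => //= y u /andP[].
Qed.

Lemma reduced_winv u : reduced u -> reduced (winv u).
Proof.
by move=> ru; rewrite -[winv u]cats0; apply: reduced_winv_cat => //; case: u {ru}.
Qed.

Lemma size_red_winv_cat u v : reduced u -> reduced v ->
  size (red (winv u ++ v)) + 2 * lcp u v = size u + size v.
Proof.
move=> ru rv; have [p [a [c [eu ev' <- h]]]] := lcp_split u v.
rewrite eu in ru *; rewrite ev' in rv *.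
have -> : red (winv (p ++ a) ++ p ++ c) = winv a ++ c.
  rewrite -(red_id (reduced_winv_cat (reduced_catr ru) (reduced_catr rv) h)).
  apply: red_ext => H f; rewrite !(winv_cat, ev_cat, ev_winv).
  by rewrite invgM -!mulgA mulKg.
by rewrite !size_cat size_winv; lia.
Qed.

(** If the common prefix were longer, the middle of the word would be a letter
    equal to its own inverse, or a cancelling pair. *)
Lemma lcp_winv u : reduced u -> u != [::] -> 2 * lcp u (winv u) < size u.
Proof.
case: u => // x0 u0; set u := x0 :: u0 => ru _; rewrite ltnNge; apply/negP => le.
have [p [a [c [eu ei sp _]]]] := lcp_split u (winv u).
have su : 0 < size u by [].
have nthp k : k < size p -> nth x0 u k = linv (nth x0 u (size u - k.+1)).
  move=> kp; have ku : k < size u by rewrite eu size_cat ltn_addr.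
  have -> : nth x0 u k = nth x0 (winv u) k by rewrite ei {1}eu !nth_cat kp.
  rewrite nth_rev size_map // (nth_map x0) //.
  by rewrite -subSn // subSS leq_subr.
have adj k : k.+1 < size u -> nth x0 u k.+1 != linv (nth x0 u k).
  by move=> ku; move: ru => /(sortedP x0); apply.
have nl l : l != linv l by case: l => i e; rewrite /linv xpair_eqE negb_and; case: e; rewrite orbT.
rewrite -sp in le; have eo := odd_double_half (size u).
have [o|o] := boolP (odd (size u)); rewrite ?o ?(negPf o) in eo.
- have := nthp (size u)./2; have -> : size u - (size u)./2.+1 = (size u)./2 by lia.
  by move=> /(_ ltac:(lia)) /eqP; rewrite (negPf (nl _)).
- have h0 : 0 < (size u)./2 by lia.
  have := nthp (size u)./2.-1; have -> : size u - (size u)./2.-1.+1 = (size u)./2 by lia.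
  move=> /(_ ltac:(lia)) e; have := adj (size u)./2.-1.
  rewrite prednK // => /(_ ltac:(lia)); rewrite e linvK eqxx.
  by [].
Qed.

End Reduced.

(** * Nielsen's theorem on the bases of a free group *)

Section HalfCode.
Variable I : finType.
Implicit Types (p q c L : word I).

Local Notation rk := (@enum_rank (I * bool)%type).
Let B := #|{: letter I}|.
Definition wnum L : nat := foldl (fun n l => n * B + rk l) 0 L.

Lemma wnum_rcons p l : wnum (rcons p l) = wnum p * B + rk l.
Proof. by rewrite /wnum -cats1 foldl_cat. Qed.

Lemma wnum_cat p c : wnum (p ++ c) = wnum p * B ^ size c + wnum c.
Proof.
elim/last_ind: c => [|c l IH]; first by rewrite cats0 muln1 addn0.
by rewrite -rcons_cat !wnum_rcons IH size_rcons expnSr mulnDl mulnA addnA.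
Qed.

Lemma wnum_inj p q : size p = size q -> wnum p = wnum q -> p = q.
Proof.
elim/last_ind: p q => [|p l IH] q; first by case: q.
case/lastP: q => [|q m]; rewrite ?size_rcons // => -[s].
rewrite !wnum_rcons => e.
have B0 : 0 < B by rewrite (leq_ltn_trans _ (ltn_ord (rk l))).
have d n (k : letter I) : (n * B + rk k) %/ B = n.
  by rewrite divnMDl // divn_small ?addn0.
have r n (k : letter I) : (n * B + rk k) %% B = rk k.
  by rewrite modnMDl modn_small.
congr rcons; first by apply: IH => //; rewrite -(d (wnum p) l) e d.
apply: (@enum_rank_inj (I * bool)%type); apply: val_inj => /=.
by rewrite -(r (wnum p) l) e r.
Qed.

(** The code breaks the ties between words of equal length.  It only looks at
    the first halves of the word and of its inverse, so that a product in
    which at most half of the word cancels changes one summand only. *)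
Definition half L : word I := take (size L)./2 L.
Definition halfcode L : nat := wnum (half L) + wnum (half (winv L)).

Lemma halfcode_winv L : halfcode (winv L) = halfcode L.
Proof. by rewrite /halfcode winvK addnC. Qed.

Lemma halfcode_le p q c : size p = size q -> size p <= size c ->
  halfcode (p ++ c) <= halfcode (q ++ c) -> wnum p <= wnum q.
Proof.
move=> s pc; rewrite /halfcode /half !size_winv !winv_cat !size_cat -s.
have hp : size p <= (size p + size c)./2 by lia.
have hc : (size p + size c)./2 <= size (winv c) by rewrite size_winv; lia.
rewrite !(takel_cat _ hc) !take_cat -s ltnNge hp /= leq_add2r !wnum_cat leq_add2r.
rewrite leq_pmul2r // expn_gt0; case: (c) => [|l c']; first by rewrite /= orbT.
by rewrite (leq_ltn_trans _ (ltn_ord (rk l))).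
Qed.

End HalfCode.

Lemma ex_lexmin (T : Type) (P : T -> Prop) (f g : T -> nat) : (exists x, P x) ->
  exists x, P x /\ forall y, P y -> f x < f y \/ f x = f y /\ g x <= g y.
Proof.
have min (Q : T -> Prop) (h : T -> nat) : (exists x, Q x) ->
    exists x, Q x /\ forall y, Q y -> h x <= h y.
  move=> [x0 Qx0].
  have ex : exists n, `[< exists x, Q x /\ h x = n >] by exists (h x0); apply/asboolP; exists x0.
  case: (ex_minnP ex) => n /asboolP[x [Qx <-]] hmin; exists x; split=> // y Qy.
  by apply: hmin; apply/asboolP; exists y.
move=> /(min _ f)[x [Px fx]].
have [|y [[Py fy] gy]] := min (fun y => P y /\ f y = f x) g; first by exists x.
exists y; split=> // z Pz; rewrite fy.
have := fx z Pz; rewrite leq_eqVlt => /orP[/eqP e|]; last by left.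
by right; split=> //; apply: gy; rewrite -e.
Qed.

Section Nielsen.
Local Open Scope group_scope.
Variables (I : finType) (G : groupType) (x c : I -> G).
Hypotheses (x_free : free_tuple x) (c_free : free_tuple c) (cx : span c = span x).

Definition nf (g : G) : word I := red (xget [::] [set L | ev x L = g]).
Definition len g := size (nf g).
Definition gp g h := lcp (nf g) (nf h).

Lemma nf_ev L : nf (ev x L) = red L.
Proof.
apply: (red_eq x_free).
by apply: (@xgetPex _ [::] [set L' | ev x L' = ev x L]); exists L.
Qed.

Lemma nf_reduced g : reduced (nf g).
Proof. exact: red_reduced. Qed.

Lemma ev_nf g : span x g -> ev x (nf g) = g.
Proof. by move=> [L <-]; rewrite nf_ev ev_red. Qed.

Lemma nfV g : span x g -> nf g^-1 = winv (nf g).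
Proof.
move=> sg; rewrite -{1}(ev_nf sg) -ev_winv nf_ev red_id //.
exact/reduced_winv/nf_reduced.
Qed.

Lemma lenV g : span x g -> len g^-1 = len g.
Proof. by move=> sg; rewrite /len nfV // size_winv. Qed.

Lemma len_gp g h : span x g -> span x h ->
  (len (g * h) + 2 * gp g^-1 h)%N = (len g + len h)%N.
Proof.
move=> sg sh; rewrite -(lenV sg) /len.
rewrite -(size_red_winv_cat (nf_reduced g^-1) (nf_reduced h)); congr (size _ + _)%N.
rewrite -nf_ev ev_cat ev_winv !ev_nf ?invgK //.
exact: subgroupV (span_subgroup x) sg.
Qed.

Lemma gpC g h : gp g h = gp h g. Proof. exact: lcpC. Qed.

Lemma gp_lt g h k : (gp g h < gp h k)%N -> gp g k = gp g h.
Proof.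
move=> lt; have := lcp_ultra (nf g) (nf h) (nf k).
have := lcp_ultra (nf g) (nf k) (nf h); move: lt.
rewrite -!/(gp _ _) (gpC k h); lia.
Qed.

Lemma gpxx g : gp g g = len g. Proof. exact: lcpxx. Qed.

Lemma nf_nil g : span x g -> len g = 0%N -> g = 1.
Proof. by move=> sg /size0nil e; rewrite -(ev_nf sg) e. Qed.

Lemma nequiv_basis d : nequiv c d -> free_tuple d /\ span d = span x.
Proof.
by move=> cd; split; [exact: nequiv_free cd c_free|rewrite -(nequiv_span cd)].
Qed.

Section Minimal.
Variable d : I -> G.
Hypothesis cd : nequiv c d.
Let code g := halfcode (nf g).
Hypothesis d_min : forall d', nequiv c d' ->
  (\sum_i len (d i) < \sum_i len (d' i))%N \/
  (\sum_i len (d i) = \sum_i len (d' i))%N /\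
  (\sum_i code (d i) <= \sum_i code (d' i))%N.

Local Notation E := (lev d).

Let E_span l : span x (E l).
Proof.
by have [_ <-] := nequiv_basis cd; rewrite -ev1; exact: span_ev.
Qed.

Let E_spanM t u : span x (E t * E u).
Proof.
have [_ <-] := nequiv_basis cd.
by have -> : E t * E u = ev d [:: t; u]; [rewrite /= mulg1|exact: span_ev].
Qed.

Let EV_span l : span x (E l)^-1.
Proof. by rewrite -lev_linv. Qed.

Let E_len l : (0 < len (E l))%N.
Proof.
rewrite lt0n; apply/eqP => /(nf_nil (E_span l)).
rewrite -ev1 => e; have [fd _] := nequiv_basis cd.
by have := red_eq (L' := [::]) fd e.
Qed.

Let codeV g : span x g -> code g^-1 = code g.
Proof. by move=> sg; rewrite /code nfV // halfcode_winv. Qed.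

Lemma min_mull t u : t.1 != u.1 ->
  (len (E u) < len (E t * E u))%N \/
  len (E u) = len (E t * E u) /\ (code (E u) <= code (E t * E u))%N.
Proof.
move=> tu; set e := E t * E u.
have se : span x e.
  exact: E_spanM.
suff [d' [cd' dd' le ce]] : exists d', [/\ nequiv c d', forall i, i != u.1 -> d' i = d i,
    len (d' u.1) = len e & code (d' u.1) = code e].
  have S (h : G -> nat) : \sum_(i | i != u.1) h (d' i) = \sum_(i | i != u.1) h (d i).
    by apply: eq_bigr => i /dd' ->.
  have := d_min cd'; rewrite !(bigD1 (P := predT) u.1) //= le ce (S len) (S code).
  have -> : len (d u.1) = len (E u)
    by rewrite /lev; case: u.2; rewrite ?lenV //; exact: (E_span (u.1, false)).
  have -> : code (d u.1) = code (E u)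
    by rewrite /lev; case: u.2; rewrite ?codeV //; exact: (E_span (u.1, false)).
  by case=> [|[]]; rewrite ?ltn_add2r; [left|move=> /addIn ->; rewrite leq_add2r; right].
have [eu|eu] := boolP u.2.
  exists (rmul u.1 (linv t) d); split.
  - by apply: (nequiv_trans cd); left; apply: tequiv_rmul => //; exact: tequiv_refl.
  - by move=> i /negPf iu; rewrite rmulE iu.
  - by rewrite rmulE eqxx lev_linv -(lenV se) /e invgM [in RHS]/lev eu invgK.
  - by rewrite rmulE eqxx lev_linv -(codeV se) /e invgM [in RHS]/lev eu invgK.
exists (lmul u.1 t d); split.
- by apply: (nequiv_trans cd); left; apply: tequiv_lmul => //; exact: tequiv_refl.
- by move=> i /negPf iu; rewrite lmulE iu.
- by rewrite lmulE eqxx /e {3}/lev (negPf eu).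
- by rewrite lmulE eqxx /e {3}/lev (negPf eu).
Qed.

Let inv_mul t u : (E t * E u)^-1 = E (linv u) * E (linv t).
Proof. by rewrite invgM !lev_linv. Qed.

Lemma min_gp t u : t.1 != u.1 ->
  (2 * gp (E t)^-1 (E u) <= len (E u))%N /\ (2 * gp (E t)^-1 (E u) <= len (E t))%N.
Proof.
move=> tu; have := len_gp (E_span t) (E_span u).
have := min_mull tu; have := @min_mull (linv u) (linv t); rewrite eq_sym => /(_ tu).
rewrite -inv_mul lev_linv !lenV //.
have w a b (Q : Prop) : (a < b)%N \/ a = b /\ Q -> (a <= b)%N by case=> [/ltnW|[->]].
move=> /w + /w; lia.
Qed.

Lemma gp_same u : (2 * gp (E u)^-1 (E u) < len (E u))%N.
Proof.
rewrite gpC /gp nfV //; apply: lcp_winv; first exact: nf_reduced.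
by rewrite -size_eq0 -lt0n E_len.
Qed.

Lemma letter_eq (t u : letter I) : t.1 = u.1 -> t != linv u -> t = u.
Proof.
case: t u => i e [j f] /= ->; rewrite /linv xpair_eqE eqxx /=.
by case: e f => [] [].
Qed.

Lemma min_gp_le t u : t != linv u -> (2 * gp (E t)^-1 (E u) <= len (E u))%N.
Proof.
move=> tu; have [e|/min_gp[]//] := eqVneq t.1 u.1.
by rewrite (letter_eq e tu) ltnW // gp_same.
Qed.

(** If its two neighbours ate up the letter [u], each would cancel exactly half
    of it.  Replacing a neighbour by its product with [u] then preserves the
    lengths and exchanges the two halves [p] and [q] at the beginning of the
    neighbour, so that [p = q] by minimality of the code, and [u] is trivial. *)
Lemma min_gp2 t u v : t != linv u -> u != linv v ->
  (gp (E t)^-1 (E u) + gp (E u)^-1 (E v) < len (E u))%N.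
Proof.
move=> tu uv; have le1 := min_gp_le tu.
have vu : linv v != linv (linv u) by rewrite linvK eq_sym.
have le2 := min_gp_le vu; rewrite !lev_linv invgK gpC lenV // in le2.
rewrite ltnNge; apply/negP => le.
have [h hE] : exists h, gp (E t)^-1 (E u) = h by eexists.
rewrite hE in le1 le; have eh : len (E u) = (2 * h)%N by lia.
have eh' : gp (E u)^-1 (E v) = h by lia.
have tu1 : t.1 != u.1.
  apply/eqP => e; have := gp_same u; have := letter_eq e tu => ?; subst t.
  by rewrite hE eh ltnn.
have uv1 : u.1 != v.1.
  apply/eqP => e; have := gp_same u; have := letter_eq e uv => ?; subst v.
  by rewrite eh' eh ltnn.
have [_ ht] := min_gp tu1; rewrite hE in ht; have [hv _] := min_gp uv1; rewrite eh' in hv.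
have [p [a [a' [et eu sp _]]]] := lcp_split (nf (E t)^-1) (nf (E u)).
have [q [c' [c2 [eui ev_ sq _]]]] := lcp_split (nf (E u)^-1) (nf (E v)).
rewrite -/(gp _ _) hE in sp; rewrite -/(gp _ _) eh' in sq.
have ea' : a' = winv q.
  have : nf (E u) = winv c' ++ winv q by rewrite -winv_cat -eui nfV // winvK.
  rewrite eu => /eqP; rewrite eqseq_cat; first by case/andP => _ /eqP.
  have : len (E u)^-1 = (2 * h)%N by rewrite lenV.
  by rewrite /len eui size_cat size_winv sp sq mul2n -addnn => /addnI.
have Eu : E u = ev x p * (ev x q)^-1 by rewrite -(ev_nf (E_span u)) eu ea' ev_cat ev_winv.
have nfs g L : ev x L = g -> size L = len g -> nf g = L.
  by move=> <-; rewrite /len nf_ev => s; exact: red_size.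
have pq : (wnum p <= wnum q)%N.
  have l1 : len (E t * E u) = len (E t).
    by have := len_gp (E_span t) (E_span u); rewrite hE; lia.
  have Et : (E t)^-1 = ev x p * ev x a by rewrite -(ev_nf (EV_span t)) et ev_cat.
  have st : len (E t) = (size p + size a)%N by rewrite -lenV // /len et size_cat.
  have n1 : nf (E t * E u)^-1 = q ++ a.
    apply: nfs; last by rewrite lenV // l1 st size_cat sp sq.
    by rewrite ev_cat invgM Et Eu invgM invgK -!mulgA mulKg.
  have := @min_mull (linv u) (linv t); rewrite eq_sym -inv_mul lev_linv !lenV // l1 ltnn.
  move=> /(_ tu1)[//|[_]]; rewrite /code et n1.
  by apply: halfcode_le; rewrite ?sp ?sq //; lia.
have qp : (wnum q <= wnum p)%N.
  have l1 : len (E u * E v) = len (E v).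
    by have := len_gp (E_span u) (E_span v); rewrite eh'; lia.
  have Ev : E v = ev x q * ev x c2 by rewrite -(ev_nf (E_span v)) ev_ ev_cat.
  have sv : len (E v) = (size q + size c2)%N by rewrite /len ev_ size_cat.
  have n1 : nf (E u * E v) = p ++ c2.
    apply: nfs; last by rewrite l1 sv size_cat sp sq.
    by rewrite ev_cat Ev Eu -!mulgA mulKg.
  have := min_mull uv1; rewrite l1 ltnn.
  move=> [//|[_]]; rewrite /code ev_ n1.
  by apply: halfcode_le; rewrite ?sp ?sq //; lia.
have epq : p = q by apply: wnum_inj; rewrite ?sp ?sq //; apply/eqP; rewrite eqn_leq pq.
have := E_len u; rewrite Eu epq mulgV.
by have -> : len 1 = 0%N by rewrite /len -[1]/(ev x [::]) nf_ev.
Qed.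

(** Induction from the right: the part of the first letter that survives in the
    product is longer than what the next letter on its left can cancel, so
    that this next letter only interacts with the first one. *)
Lemma min_len_ge l L : reduced (l :: L) ->
  (forall t, t != linv l -> (gp (E t)^-1 (E l) < gp (ev d (l :: L)) (E l))%N) /\
  (size L + gp (ev d (l :: L)) (E l) <= len (ev d (l :: L)))%N.
Proof.
have sd L' : span x (ev d L') by have [_ <-] := nequiv_basis cd; exact: span_ev.
elim: L l => [|m L IH] l.
  move=> _; rewrite ev1 gpxx; split=> [t tl|]; last by [].
  have h2 a b : (0 < b -> 2 * a <= b -> a < b)%N by lia.
  exact: h2 (E_len l) (min_gp_le tl).
move=> rL; have /IH[IH1 IH2] : reduced (m :: L) by exact: path_sorted rL.
have lm : l != linv m.
  by move: rL => /= /andP[+ _]; apply: contra => /eqP->; rewrite linvK.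
set P := ev d (m :: L) in IH1 IH2 *.
have -> : ev d [:: l, m & L] = E l * P by [].
have e1 : gp (E l)^-1 P = gp (E l)^-1 (E m).
  by apply: gp_lt; rewrite [X in (_ < X)%N]gpC; exact: IH1.
have sP : span x P by exact: sd.
have sQ : span x (E l * P) by exact: (sd [:: l, m & L]).
have e2 := len_gp (E_span l) sP; rewrite e1 in e2.
have e3 := len_gp (subgroupV (span_subgroup x) sQ) (E_span l).
rewrite invgM mulgVK -invgM invgK !lenV // in e3.
have lt := IH1 l lm.
have arith (lQ gm ll lP gQ gP s : nat) : (lQ + 2 * gm = ll + lP -> lP + 2 * gQ = lQ + ll ->
    gm < gP -> s + gP <= lP -> s.+1 + gQ <= lQ /\ gQ + gm = ll)%N by lia.
have [le eQ] := arith _ _ _ _ _ _ _ e2 e3 lt IH2; split=> // t tl.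
rewrite -(ltn_add2r (gp (E l)^-1 (E m))).
by rewrite [X in (_ < X)%N]eQ; exact: min_gp2.
Qed.

Lemma min_perm : exists s : {perm I}, forall i, exists e, x i = E (s i, e).
Proof.
have [fd sd] := nequiv_basis cd.
have H i : exists l, x i = E l.
  have : span d (x i) by rewrite sd; exact: span_gen.
  move=> [L]; rewrite -ev_red => eL; case e : (red L) eL => [|l L'] eL.
    have : ev x [:: (i, false)] = ev x [::] by rewrite ev1 -[lev _ _]/(x i) -eL.
    by move/(red_eq x_free).
  have rL : reduced (l :: L') by rewrite -e red_reduced.
  have [lt le] := min_len_ge rL.
  have l1 : len (ev d (l :: L')) = 1%N.
    by rewrite eL /len -[x i](ev1 x (i, false)) nf_ev.
  have ll : l != linv l
    by case: (l) => j f; rewrite /linv xpair_eqE negb_and; case: f; rewrite orbT.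
  have := lt l ll; rewrite l1 in le => ?.
  have : size L' = 0%N by lia.
  by move=> /size0nil L'0; exists l; rewrite -eL L'0 ev1.
have [f fE] := choice H.
have finj : injective (fun i => (f i).1).
  move=> i j /= fij; apply/eqP; apply: contraT => ij; exfalso.
  have [e|e] := eqVneq (f i) (f j).
    have : ev x [:: (i, false)] = ev x [:: (j, false)] by rewrite !ev1 -![lev _ _]/(x _) !fE e.
    by move/(red_eq x_free) => /= -[/eqP]; rewrite (negPf ij).
  have e2 : f i = linv (f j).
    by case: (f i) (f j) fij e => a e1 [b e2] /= ->; case: e1 e2 => [] [] //; rewrite eqxx.
  have : ev x [:: (i, false)] = ev x [:: (j, true)].
    by rewrite !ev1 -[lev _ _]/(x _) -[lev _ (j, true)]/((x j)^-1) !fE e2 lev_linv.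
  by move/(red_eq x_free).
exists (perm finj) => i; exists (f i).2.
by rewrite permE fE -surjective_pairing.
Qed.

End Minimal.

(** A basis that is minimal in its Nielsen class, for the total length and then
    for the total code of the half words, is a signed permutation of the given
    basis: products without cancelling pairs are too long otherwise. *)
Theorem nielsen : nequiv x c.
Proof.
have [d [cd dmin]] := ex_lexmin (fun d => \sum_i len (d i))%N
  (fun d => \sum_i halfcode (nf (d i)))%N (ex_intro (nequiv c) c (nequiv_refl c)).
have [s /choice[e xE]] := min_perm cd dmin.
apply: nequiv_sym; apply: (nequiv_trans cd); apply: (nequiv_trans (nequiv_perm s d)).
have -> : x = foldr (fun i b => invat i b) (d \o s) [seq i <- enum I | e i].
  apply/funext => i; rewrite xE.
  have inv b (r : seq I) : uniq r -> foldr (fun i b => invat i b) b r i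
      = if i \in r then (b i)^-1 else b i.
    elim: r => [|j r IH] //= /andP[jr /IH {}IH]; rewrite invatE IH inE.
    by case: (eqVneq i j) => [->|//]; rewrite (negPf jr).
  by rewrite inv ?(filter_uniq _ (enum_uniq _)) // mem_filter mem_enum andbT.
case: (pselect (exists i : I, True)) => [[i0 _]|noI].
  have := tequiv_invats [seq i <- enum I | e i] i0 (d \o s).
  case: odd => h; apply: nequiv_sym; last by left.
  by right; exists i0.
left; have -> : foldr (fun i b => invat i b) (d \o s) [seq i <- enum I | e i] = d \o s.
  by apply/funext => i; case: noI; exists i.
exact: tequiv_refl.
Qed.

End Nielsen.

(** * Free bases in the sense of the universal property *)

Section TupleMap.
Local Open Scope group_scope.
Variables (I : finType) (G H : groupType) (b : I -> G) (c : I -> H).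

(** On [span b], with [b] free, this is the homomorphism that sends [b i] to
    [c i]; elsewhere it is constant. *)
Definition tmap (g : G) : H := ev c (xget [::] [set L | ev b L = g]).

Lemma tmap_ev L : free_tuple b -> tmap (ev b L) = ev c L.
Proof.
move=> fb; apply: (free_tuple_eq _ fb).
by apply: (@xgetPex _ [::] [set L' | ev b L' = ev b L]); exists L.
Qed.

Lemma tmapM g h : free_tuple b -> span b g -> span b h -> tmap (g * h) = tmap g * tmap h.
Proof. by move=> fb [L <-] [L' <-]; rewrite -ev_cat !tmap_ev // ev_cat. Qed.

End TupleMap.

Section FreeOn.
Local Open Scope group_scope.
Variables (F : groupType).

Section SubgroupType.
Variable W : set F.

Record sgrp_elt := SGrp { sgrp_val : F; sgrp_mem : W sgrp_val }.

Variable sW : subgroup W.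

(** The mention of [sW] lets the group structure be inferred from the type. *)
Definition sgrp := let _ := sW in sgrp_elt.

HB.instance Definition _ := gen_eqMixin sgrp.
HB.instance Definition _ := gen_choiceMixin sgrp.

Lemma sgrp_inj (u v : sgrp) : sgrp_val u = sgrp_val v -> u = v.
Proof.
by case: u v => g gW [h hW] /= e; subst h; congr SGrp; exact: Prop_irrelevance.
Qed.

Definition sgrp1 : sgrp := SGrp (subgroup1 sW).
Definition sgrpM (u v : sgrp) : sgrp := SGrp (subgroupM sW (sgrp_mem u) (sgrp_mem v)).
Definition sgrpV (u : sgrp) : sgrp := SGrp (subgroupV sW (sgrp_mem u)).

Lemma sgrpMA : associative sgrpM.
Proof. by move=> u v w; apply: sgrp_inj; exact: mulgA. Qed.
Lemma sgrp1M : left_id sgrp1 sgrpM.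
Proof. by move=> u; apply: sgrp_inj; exact: mul1g. Qed.
Lemma sgrpM1 : right_id sgrp1 sgrpM.
Proof. by move=> u; apply: sgrp_inj; exact: mulg1. Qed.
Lemma sgrpVM : left_inverse sgrp1 sgrpV sgrpM.
Proof. by move=> u; apply: sgrp_inj; exact: mulVg. Qed.
Lemma sgrpMV : right_inverse sgrp1 sgrpV sgrpM.
Proof. by move=> u; apply: sgrp_inj; exact: mulgV. Qed.

HB.instance Definition _ := isGroup.Build sgrp sgrpMA sgrp1M sgrpM1 sgrpVM sgrpMV.

End SubgroupType.

Variables (I : Type) (x : I -> F).
Hypothesis x_free : free_on x.

Lemma free_on_tuple : free_tuple x.
Proof.
move=> H h L e; have [phi [[phiM phix] _]] := x_free h.
have := @morph_ev _ _ _ setT phi x L (subgroupT F) (fun u v _ _ => phiM u v) (fun=> Logic.I).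
rewrite e (_ : phi \o x = h); last by apply/funext => i; exact: phix.
by move=> <-; apply: (mulgI (phi 1)); rewrite -phiM !mulg1.
Qed.

(** The retraction onto [span x] followed by the inclusion is the identity, by
    uniqueness in the universal property. *)
Lemma free_on_span : span x = setT.
Proof.
apply/seteqP; split=> // g _.
pose S : groupType := sgrp (span_subgroup x).
have [phi [[phiM phix] _]] := x_free (fun i => SGrp (span_gen x i) : S).
have [psi [_ uniq]] := x_free x.
have e1 : psi = id by apply: uniq; split.
have e2 : psi = fun g => sgrp_val (phi g).
  by apply: uniq; split=> [u v|i]; rewrite ?phiM ?phix.
have -> : g = sgrp_val (phi g) by rewrite -[RHS]/((fun g => sgrp_val (phi g)) g) -e2 e1.
exact: sgrp_mem.
Qed.

End FreeOn.

Section Counts.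
Variable I : finType.

Definition wc (e : bool) (x : I) (L : word I) : nat :=
  count (fun l : letter I => (l.1 == x) && (l.2 == e)) L.
Definition occ (x : I) (L : word I) : nat := count (fun l : letter I => l.1 == x) L.

(** The exponent sum of [x] in [L] is divisible by [m]. *)
Definition balanced m x L : bool := wc false x L == wc true x L %[mod m].

Lemma occ_cons x l L : occ x (l :: L) = (l.1 == x) + occ x L. Proof. by []. Qed.
Lemma wc_cons e x l L : wc e x (l :: L) = ((l.1 == x) && (l.2 == e)) + wc e x L.
Proof. by []. Qed.

End Counts.
Arguments occ : simpl never.
Arguments wc : simpl never.

(** * Cyclic coverings *)

Section Cover.
Local Open Scope group_scope.
Variables (q : nat) (J : finType).
Local Notation p := q.+2.
Local Notation K := (J * 'I_p)%type.

(** For a basis [b] of a free group, [cover b] is the Schreier basis of the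
    kernel of the homomorphism to [Z/p] that sends [b None] to [1] and the
    other entries to [0]. *)
Definition cover_sub (k : option K) : word (option J) :=
  match k with
  | None => nseq p (None, false)
  | Some (j, i) => nseq i (None, false) ++ (Some j, false) :: nseq i (None, true)
  end.
Definition cover (G : groupType) (b : option J -> G) : option K -> G := sub cover_sub b.

Section CoverGroup.
Variable G : groupType.
Implicit Type b : option J -> G.

Lemma coverN b : cover b None = b None ^+ p.
Proof. by rewrite /cover /sub ev_nseq. Qed.

Lemma coverS b j i : cover b (Some (j, i)) = b None ^+ i * b (Some j) * b None ^- i.
Proof. by rewrite /cover /sub ev_cat ev_cons !ev_nseq /lev /= expVgn mulgA. Qed.

(** [rw i L] pushes [b None ^+ i] through the word [L], writing down an entry of
    [cover b] for every letter other than [None], and for the letters [None]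
    that pass from [p.-1] to [0] or back. *)
Fixpoint rw (i : nat) (L : word (option J)) : word (option K) * nat :=
  match L with
  | [::] => ([::], i)
  | (None, false) :: L' =>
      if i == q.+1 then ((None, false) :: (rw 0 L').1, (rw 0 L').2) else rw i.+1 L'
  | (None, true) :: L' =>
      if i is i'.+1 then rw i' L' else ((None, true) :: (rw q.+1 L').1, (rw q.+1 L').2)
  | (Some j, e) :: L' => ((Some (j, inord i), e) :: (rw i L').1, (rw i L').2)
  end.

Lemma rw_ev b i L : i < p ->
  b None ^+ i * ev b L = ev (cover b) (rw i L).1 * b None ^+ (rw i L).2 /\ (rw i L).2 < p.
Proof.
elim: L i => [|[[j|] e] L IH] i ip; first by rewrite mul1g mulg1.
- have [IH1 IH2] := IH i ip; rewrite /=; split=> //.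
  rewrite -mulgA -IH1 /lev /= coverS inordK //.
  by case: e; rewrite 2?invgM ?invgK -!mulgA mulKg.
- case: e => /=.
    case: i ip => [|i] ip.
      have [IH1 IH2] := IH q.+1 (leqnn _); split=> //=.
      rewrite -mulgA -IH1 /lev /= coverN.
      by rewrite (expgSr _ q.+1) invgM -!mulgA mulKg mul1g.
    have [IH1 IH2] := IH i (ltnW ip); split=> //.
    rewrite -IH1 /lev /= expgSr -!mulgA.
    by rewrite mulVKg.
  case: eqP => [->|/eqP iq].
    have [IH1 IH2] := IH 0 isT; split=> //=.
    by rewrite -mulgA -IH1 /lev /= coverN (expgSr _ q.+1) expg0 mul1g mulgA.
  have ip1 : i.+1 < p by rewrite ltn_neqAle ip andbT.
  have [IH1 IH2] := IH i.+1 ip1; split=> //.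
  by rewrite -IH1 /lev /= expgSr mulgA.
Qed.

End CoverGroup.

(** The freeness of [cover b] comes from the representation induced from a
    homomorphism [h] defined on the kernel: [b] acts on [p] copies of the
    target, in such a way that [cover b] acts by [h] on the copy [0]. *)
Lemma cover_free (G : groupType) (b : option J -> G) : free_tuple b -> free_tuple (cover b).
Proof.
move=> fb H h L; rewrite ev_sub => bL.
pose T : Type := ('I_p * H)%type.
pose X (z : T) : T := if z.1 == 0%N :> nat then (ord_max, h None * z.2) else (inord z.1.-1, z.2).
pose X' (z : T) : T :=
  if z.1 == q.+1 :> nat then (ord0, (h None)^-1 * z.2) else (inord z.1.+1, z.2).
have XK : cancel X X'.
  move=> [[[|i] lti] g]; rewrite /X /X' /= ?eqxx /=.
    by rewrite mulKg; congr (_, _); exact: val_inj.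
  rewrite inordK; last exact: ltnW.
  rewrite ifN; last by rewrite neq_ltn -ltnS lti.
  by congr (_, _); apply: val_inj; rewrite /= inordK.
have XK' : cancel X' X.
  move=> [[i lti] g]; rewrite /X /X' /=; case: (i =P q.+1) => [e|/eqP e] /=.
    by rewrite mulVKg; congr (_, _); exact: val_inj.
  have lti1 : i.+1 < p by rewrite ltn_neqAle lti andbT eqSS.
  by rewrite inordK //=; congr (_, _); apply: val_inj; rewrite /= inordK.
pose Y j (z : T) : T := (z.1, h (Some (j, z.1)) * z.2).
pose Y' j (z : T) : T := (z.1, (h (Some (j, z.1)))^-1 * z.2).
have YK j : cancel (Y j) (Y' j) by case=> i g; rewrite /Y /Y' /= mulKg.
have YK' j : cancel (Y' j) (Y j) by case=> i g; rewrite /Y /Y' /= mulVKg.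
pose act (k : option J) : sym T := if k is Some j then Sym (YK j) (YK' j) else Sym XK XK'.
have Xi i g : i < p -> (act None ^+ i : sym T) (inord i, g) = (ord0, g).
  elim: i => [|i IH] ip; first by congr (_, _); apply: val_inj; rewrite /= inordK.
  by rewrite expgSr /= /X /= inordK //= IH // ltnW.
have XiV i g : i < p -> (act None ^- i : sym T) (ord0, g) = (inord i, g).
  by move=> ip; apply: (can_inj (@sfunK _ (act None ^+ i))); rewrite Xi //
    -[LHS]/((act None ^+ i * act None ^- i : sym T) _) mulgV.
have actE k g : (cover act k : sym T) (ord0, g) = (ord0, h k * g).
  case: k => [[j i]|].
    rewrite coverS -mulgA
      -[LHS]/((act None ^+ i : sym T) ((act (Some j)) ((act None ^- i : sym T) (ord0, g)))).
    rewrite XiV // -[LHS]/((act None ^+ i : sym T) (inord i, h (Some (j, inord i)) * g)).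
    by rewrite Xi // inord_val.
  rewrite coverN expgSr -[LHS]/((act None ^+ q.+1 : sym T) (ord_max, h None * g)).
  by rewrite (_ : ord_max = inord q.+1) ?Xi //; apply: val_inj; rewrite /= inordK.
have evE L' g : (ev (cover act) L' : sym T) (ord0, g) = (ord0, ev h L' * g).
  elim: L' g => [|[k e] L' IH] g; first by rewrite mul1g.
  rewrite !ev_cons
    -[LHS]/((lev (cover act) (k, e) : sym T) ((ev (cover act) L' : sym T) (ord0, g))).
  rewrite IH -mulgA; case: e; last exact: actE.
  apply: (can_inj (@sfunK _ (cover act k))); rewrite actE mulVKg.
  by rewrite -[LHS]/((cover act k * (cover act k)^-1 : sym T) (ord0, ev h L' * g)) mulgV.
have := evE L 1; rewrite ev_sub (fb _ act _ bL) mulg1.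
by case.
Qed.

Section RewriteCounts.
Implicit Types (L : word (option J)) (i : nat).

Lemma rw_size i L : size (rw i L).1 + occ None L = size L + occ None (rw i L).1.
Proof.
elim: L i => [|[[j|] e] L IH] i //=.
- by have := IH i; rewrite !occ_cons /= !add0n !addSn => ->.
- case: e; rewrite occ_cons /=.
    case: i => [|i] /=; last by rewrite addnCA IH.
    by rewrite !occ_cons /= addSn addnCA IH addnCA.
  case: eqP => _ /=; last by rewrite addnCA IH.
  by rewrite !occ_cons /= addSn addnCA IH addnCA.
Qed.

Lemma rw_occ i L : occ None (rw i L).1 <= occ None L.
Proof.
elim: L i => [|[[j|] e] L IH] i //=; first by rewrite !occ_cons /= !add0n.
case: e; rewrite occ_cons /=.
  case: i => [|i] /=; last by apply: leq_trans (IH i) _; rewrite add1n.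
  by rewrite !occ_cons /= !add1n ltnS.
case: eqP => _ /=; last by apply: leq_trans (IH i.+1) _; rewrite add1n.
by rewrite !occ_cons /= !add1n ltnS.
Qed.

(** The starting position is chosen such that the first letter [None] does not
    pass between [p.-1] and [0], and hence leaves no trace. *)
Lemma rw_shorter L : exists2 i, i < p & 0 < occ None L -> occ None (rw i L).1 < occ None L.
Proof.
elim: L => [|[[j|] e] L [i ip IH]]; first by exists 0.
  by exists i.
exists (e : nat); first by case: e.
by case: e => _ /=; rewrite occ_cons /= add1n ltnS rw_occ.
Qed.

Lemma rw_wcN i L : i < p ->
  i + wc false None L + p * wc true None (rw i L).1 =
  wc true None L + p * wc false None (rw i L).1 + (rw i L).2.
Proof.
elim: L i => [|[[j|] e] L IH] i ip; first by rewrite /= !muln0 !addn0.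
  by have := IH i ip; rewrite !wc_cons.
case: e => /=.
  case: i ip => [|i] ip; rewrite !wc_cons /=.
    have ar1 a X c Y f : q.+1 + a + X = c + Y + f ->
      0 + (0 + a) + (p + X) = 1 + c + Y + f by lia.
    by rewrite [(p * (1 + _))%N]mulnDr muln1; apply: ar1; exact: IH.
  have ar2 a X c Y f : i + a + X = c + Y + f ->
    i.+1 + (0 + a) + X = 1 + c + Y + f by lia.
  by apply: ar2; exact: IH (ltnW ip).
case: eqP => [->|/eqP iq]; rewrite !wc_cons /=.
  have ar3 a X c Y f : 0 + a + X = c + Y + f ->
    q.+1 + (1 + a) + X = 0 + c + (p + Y) + f by lia.
  by rewrite [(p * (1 + _))%N]mulnDr muln1; apply: ar3; exact: IH.
have ip1 : i.+1 < p by rewrite ltn_neqAle ip andbT.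
have ar4 a X c Y f : i.+1 + a + X = c + Y + f ->
  i + (1 + a) + X = 0 + c + Y + f by lia.
by apply: ar4; exact: IH.
Qed.

Lemma rw_wcS i L e j : \sum_k wc e (Some (j, k)) (rw i L).1 = wc e (Some j) L.
Proof.
elim: L i => [|[[j'|] e'] L IH] i /=; first by rewrite big1.
- under eq_bigr => k _ do rewrite wc_cons /=.
  rewrite wc_cons -(IH i) big_split /= (bigD1 (inord i)) //= big1 ?addn0.
    congr (_ + _); congr (nat_of_bool (_ && _)).
    by apply/eqP/eqP => [[->]|[->]].
  by move=> k ki; case: eqP => // -[_ ek]; rewrite ek eqxx in ki.
- have drop e2 i2 : \sum_k wc e (Some (j, k)) ((None, e2) :: (rw i2 L).1) = wc e (Some j) L.
    by rewrite -(IH i2); apply: eq_bigr => k _.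
  rewrite wc_cons add0n; case: e'; first by case: i => [|i] /=; rewrite ?drop ?IH.
  by case: eqP => _ /=; rewrite ?drop ?IH.
Qed.

Lemma rw_avoid i L (js : J) : occ (Some js) L = 0 ->
  all (fun l => if l.1 is Some k then k.1 != js else true) (rw i L).1.
Proof.
elim: L i => [|[[j|] e] L IH] i //=.
- rewrite occ_cons /= => /eqP; rewrite addn_eq0 eqb0 => /andP[ne /eqP/(IH i) ->].
  by rewrite andbT.
- rewrite occ_cons /= add0n => h; case: e; first by case: i => [|i] /=; apply: IH.
  by case: eqP => _ /=; apply: IH.
Qed.

Lemma rw_end i L : i < p -> balanced p None L -> (rw i L).2 = i.
Proof.
move=> ip /eqP bal; have [_ lt] := rw_ev (fun=> 1 : sym unit) L ip.
have e : (i + wc true None L = (rw i L).2 + wc true None L %[mod p])%N.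
  rewrite -modnDmr -bal modnDmr -(modnMDl (wc true None (rw i L).1)) mulnC addnC rw_wcN //.
  have ar a b c : (a + p * b + c = b * p + (c + a))%N by rewrite [(p * b)%N]mulnC; lia.
  by rewrite ar modnMDl.
by move/eqP: e; rewrite eqn_modDr !modn_small // => /eqP/esym.
Qed.

Lemma rw_wcN0 i L : i < p -> wc false None L = wc true None L ->
  wc false None (rw i L).1 = wc true None (rw i L).1.
Proof.
move=> ip e; have b : balanced p None L by rewrite /balanced e.
have := rw_wcN L ip; rewrite (rw_end ip b) e => h.
apply/eqP; rewrite -(eqn_pmul2l (isT : 0 < p)); apply/eqP; lia.
Qed.

End RewriteCounts.

Section CoverSpan.
Variable G : groupType.
Implicit Type b : option J -> G.

Lemma cover_conj b i L : i < p -> balanced p None L ->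
  b None ^+ i * ev b L * b None ^- i = ev (cover b) (rw i L).1.
Proof.
move=> ip bal; have [-> _] := rw_ev b L ip.
by rewrite rw_end // mulgK.
Qed.

Lemma cover_spanS b : span (cover b) `<=` span b.
Proof. exact: span_sub. Qed.

Lemma span_coverP b (P : set G) : subgroup P -> (forall k, P (cover b k)) ->
    (forall i, 0 < i < p -> ~ P (b None ^+ i)) ->
  span (cover b) = span b `&` P.
Proof.
move=> sP Pc Px; apply/seteqP; split=> [g sg|_ [[L <-] Pg]].
  by split; [exact: cover_spanS|exact: span_min sg].
have [e lt] := rw_ev b L (isT : 0 < p); rewrite expg0 mul1g in e.
rewrite e; rewrite {}e in Pg; case: (rw 0 L) lt Pg => o [|f] /= lt Pg.
  by rewrite mulg1; exact: span_ev.
exfalso; apply: (Px f.+1 lt).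
rewrite -[b None ^+ f.+1](mulKg (ev (cover b) o)).
apply: subgroupM => //; apply: subgroupV => //.
by apply: (span_min sP Pc); exact: span_ev.
Qed.

(** The next two lemmas compare the moves of a basis with those of its cover. *)
Lemma cover_rmul b j l : j != l ->
  cover (rmul (Some j) (Some l, false) b) = fun k =>
    if k is Some (j', i) then
      if j' == j then cover b k * cover b (Some (l, i)) else cover b k
    else cover b k.
Proof.
move=> jl; apply/funext => -[[j' i]|]; last by rewrite !coverN rmulE.
rewrite !coverS !rmulE /=; case: (j' =P j) => [->|/eqP ne]; last first.
  by rewrite ifN //; apply: contra ne => /eqP[->].
by rewrite eqxx /lev /= !mulgA mulgVK.
Qed.

Lemma cover_invat b j : cover (invat (Some j) b) =
  foldr (fun k c => invat k c) (cover b) [seq Some (j, i) | i <- enum 'I_p].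
Proof.
have inv c (r : seq (option K)) k : uniq r -> foldr (fun k c => invat k c) c r k
    = if k \in r then (c k)^-1 else c k.
  elim: r => [|k' r IH] //= /andP[jr /IH {}IH]; rewrite invatE IH inE.
  by case: (eqVneq k k') => [->|//]; rewrite (negPf jr).
apply/funext => k; rewrite inv; last by rewrite map_inj_uniq ?enum_uniq // => i i' [].
case: k => [[j' i]|]; last first.
  rewrite !coverN invatE /= ifN //; apply/negP => /mapP[i _]; discriminate.
rewrite !coverS !invatE /=.
case: (j' =P j) => [->|/eqP ne].
  rewrite eqxx ifT; last by apply/mapP; exists i => //; rewrite mem_enum.
  by rewrite 2!invgM invgK mulgA.
rewrite ifN; last by apply: contra ne => /eqP[->].
by rewrite ifN //; apply: contra ne => /mapP[i' _ [-> _]].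
Qed.

End CoverSpan.

End Cover.
Arguments cover_sub q {J} k.
Arguments cover q {J G} b.
Arguments rw q {J} i L.

(** * Elements of the commensurator as changes of bases *)

Section Carries.
Local Open Scope group_scope.
Local Open Scope quotient_scope.
Variables (p : nat) (F : groupType).
Local Notation C := (pcomm p F).

Section Tuples.
Variable I : finType.
Implicit Types (b : I -> F) (c d g : C).

Definition pbasis b : Prop := free_tuple b /\ p_open_subgroup p (span b).

(** A p-open basis turns elements of the commensurator into tuples: two
    elements that carry the basis [b] to the same tuple are equal. *)
Definition carries c b b' : Prop := exists f : p_iso p F,
  [/\ \pi_C f = c, span b `<=` pdom f & forall i, f (b i) = b' i].

Lemma pfun_ev (f : p_iso p F) b L : span b `<=` pdom f -> f (ev b L) = ev (f \o b) L.
Proof.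
move=> sb; apply: (@morph_ev _ _ _ (pdom f)).
- by case: (pdom_open f).
- by move=> x y dx dy; exact: pfunMin.
- by move=> i; apply: sb; exact: span_gen.
Qed.

Lemma carries_uniq c d b b' : p_open_subgroup p (span b) ->
  carries c b b' -> carries d b b' -> c = d.
Proof.
move=> ob [f [<- sf fb]] [g [<- sg gb]]; apply/pcomm_piP; exists (span b); split=> //.
  by move=> x bx; split; [exact: sf|exact: sg].
move=> x /set_mem[L <-]; rewrite !pfun_ev //; congr ev.
by apply/funext => i /=; rewrite fb gb.
Qed.

Lemma carries1 b : carries 1 b b.
Proof. by exists (p_iso_id p F). Qed.

Lemma carries_mul c d b b' b'' : carries c b b' -> carries d b' b'' -> carries (d * c) b b''.
Proof.
move=> [f [<- sf fb]] [g [<- sg gb]]; exists (p_iso_comp g f); split.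
- by rewrite -pcomm_mulE.
- move=> _ [L <-]; have dL := sf _ (span_ev b L); split=> //; split; first exact: pfun_cod.
  apply: sg; rewrite pfun_ev //; rewrite (_ : f \o b = b'); first exact: span_ev.
  by apply/funext => i; exact: fb.
- by move=> i /=; rewrite fb gb.
Qed.

Lemma carries_inv c b b' : carries c b b' -> carries c^-1 b' b.
Proof.
move=> [f [<- sf fb]]; exists (p_iso_inv f); split.
- apply: (mulIg (\pi_C f)); rewrite mulVg -[LHS]/(pcomm_mul _ _) pcomm_mulE.
  apply/pcomm_piP; apply: p_iso_eq_on => t [dt _]; split=> //.
  exact: pinv_funK.
- apply: span_min; first by case: (pcod_open f).
  by move=> i; rewrite -fb; apply: pfun_cod; apply: sf; exact: span_gen.
- by move=> i; rewrite -fb; apply: pinv_funK; apply: sf; exact: span_gen.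
Qed.

Lemma carries_conj c g b1 b1' b2 b2' :
  carries g b1 b2 -> carries g b1' b2' -> carries c b1 b1' -> carries (g * c * g^-1) b2 b2'.
Proof.
move=> g1 g2 c1; apply: (carries_mul (carries_inv g1)).
exact: carries_mul c1 g2.
Qed.

Lemma carries_exists b b' : pbasis b -> pbasis b' -> exists c, carries c b b'.
Proof.
move=> [fb ob] [fb' ob'].
have bij : set_bij (span b) (span b') (tmap b b').
  split=> [_ [L <-]|_ _ /set_mem[L <-] /set_mem[L' <-]|_ [L <-]].
  - by rewrite tmap_ev //; exact: span_ev.
  - by rewrite !tmap_ev // => /(free_tuple_eq _ fb')->.
  - by exists (ev b L); [exact: span_ev|exact: tmap_ev].
have morph : {in span b &, {morph tmap b b' : x y / x * y}}.
  by move=> x y /set_mem sx /set_mem sy; exact: tmapM.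
exists (\pi_C (PIso ob ob' bij morph)); exists (PIso ob ob' bij morph); split=> // i /=.
by rewrite -[b i](ev1 b (i, false)) tmap_ev // ev1.
Qed.

Lemma carries_pbasis c b b' : carries c b b' -> pbasis b -> pbasis b'.
Proof.
move=> [f [_ sf fb]] [fr ob].
have e : f \o b = b' by apply/funext => i; exact: fb.
have f1 : f 1 = 1.
  apply: (mulgI (f 1)); rewrite -pfunMin ?mulg1 //;
  by apply: subgroup1; case: (pdom_open f).
split.
  move=> H h L; rewrite -e -pfun_ev // -f1 => fL; apply: fr; apply: pfun_inj fL.
    exact/sf/span_ev.
  by apply: subgroup1; case: (pdom_open f).
have -> : span b' = pcod f `&` p_iso_inv f @^-1` span b.
  apply/seteqP; split=> [_ [L <-]|y [cy [L eL]]].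
    rewrite -e -pfun_ev //; split; first exact/pfun_cod/sf/span_ev.
    by rewrite /= pinv_funK; [exact: span_ev|exact/sf/span_ev].
  have [_ <-] := pinv_funP cy; exists L.
  by rewrite -e -pfun_ev // eL.
apply: p_open_preimage => //; first exact: pcod_open.
exact: pinv_morph.
Qed.

End Tuples.

Lemma carries_sub (I J : finType) c (b b' : I -> F) (s : J -> word I) :
  carries c b b' -> carries c (sub s b) (sub s b').
Proof.
move=> [f [fc sf fb]]; exists f; split=> //.
  by apply: subset_trans sf; exact: span_sub.
move=> j; rewrite /sub pfun_ev //; congr ev; apply/funext => i; exact: fb.
Qed.

Lemma carries_reindex (I J : finType) c (b b' : I -> F) (s : J -> I) :
  carries c b b' -> carries c (b \o s) (b' \o s).
Proof.
have e (h : I -> F) : h \o s = sub (fun j => [:: (s j, false)]) h.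
  by apply/funext => j; rewrite /sub ev1.
by move=> cb; rewrite !e; exact: carries_sub.
Qed.

Lemma carries_rmulV (I : finType) c (b : I -> F) i l : l.1 != i ->
  carries c b (rmul i l b) -> carries c^-1 b (rmul i (linv l) b).
Proof.
move=> li /(carries_sub (rsub i (linv l))) cb.
by rewrite -/(rmul _ _ _) -/(rmul _ _ _) rmulK // in cb; exact: carries_inv.
Qed.

(** ** Inner automorphisms *)

Definition conj_fun (w x : F) : F := w * x * w^-1.

Lemma conj_bij w : set_bij [set: F] [set: F] (conj_fun w).
Proof.
split=> // [x y _ _|y _].
  by move=> /mulIg/mulgI.
by exists (conj_fun w^-1 y) => //; rewrite /conj_fun invgK -!mulgA mulVKg mulgV mulg1.
Qed.

Lemma conj_funM w x y : conj_fun w (x * y) = conj_fun w x * conj_fun w y.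
Proof. by rewrite /conj_fun -!mulgA mulKg. Qed.

Definition conj_iso w : p_iso p F :=
  @PIso p F setT setT (conj_fun w) (p_openT p F) (p_openT p F) (conj_bij w)
    (fun x y _ _ => conj_funM w x y).

Definition inn w : C := \pi_C (conj_iso w).

Lemma innM w v : inn (w * v) = inn w * inn v.
Proof.
rewrite -[RHS]/(pcomm_mul _ _) pcomm_mulE; apply/pcomm_piP.
apply: p_iso_eq_on => t _; split=> //=.
by rewrite /conj_fun invgM !mulgA.
Qed.

Lemma inn1 : inn 1 = 1.
Proof. by apply: (mulgI (inn 1)); rewrite -innM !mulg1. Qed.

Lemma innV w : inn w^-1 = (inn w)^-1.
Proof. by apply: (mulIg (inn w)); rewrite -innM !mulVg inn1. Qed.

Lemma carries_inn (I : finType) w (b : I -> F) : carries (inn w) b (conj_fun w \o b).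
Proof. by exists (conj_iso w). Qed.

Lemma inn_conj (f : p_iso p F) w : pdom f w ->
  \pi_C f * inn w * (\pi_C f)^-1 = inn (f w).
Proof.
move=> dw; apply: (mulIg (\pi_C f)); rewrite mulgVK.
rewrite -[LHS]/(pcomm_mul _ _) -[RHS]/(pcomm_mul _ _) !pcomm_mulE.
have sd : subgroup (pdom f) by case: (pdom_open f).
have wV := subgroupV sd dw.
apply/pcomm_piP; apply: p_iso_eq_on => t /= [_ [_ dt]].
have dt' : pdom f t.
  have -> : t = w^-1 * conj_fun w t * w by rewrite /conj_fun -!mulgA mulVg mulg1 mulKg.
  by apply: subgroupM => //; exact: subgroupM.
split; first by split=> //; split=> //; exact: pfun_cod.
have fw : f w^-1 = (f w)^-1.
  have f1 : f 1 = 1 by apply: (mulgI (f 1)); rewrite -pfunMin ?mulg1 //; exact: subgroup1.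
  by apply: (mulgI (f w)); rewrite -pfunMin // !mulgV.
by rewrite /conj_fun !pfunMin ?fw //; exact: subgroupM.
Qed.

Lemma carries_inn_conj (I : finType) c w (b b' : I -> F) L : carries c b b' ->
  ev b L = w -> c * inn w * c^-1 = inn (ev b' L).
Proof.
move=> [f [<- sf fb]] <-; rewrite inn_conj; last exact/sf/span_ev.
rewrite pfun_ev //; congr (inn (ev _ _)); apply/funext => i; exact: fb.
Qed.

End Carries.

(** * Bases of the p-open subgroups *)

Section Reach.
Local Open Scope group_scope.
Local Open Scope quotient_scope.
Variables (q m : nat).
Local Notation p := q.+2.
Hypothesis p_prime : prime p.
Variables (F : groupType) (x0 : option 'I_m.+1 -> F).
Hypotheses (x0_free : free_tuple x0) (x0_span : span x0 = setT).
Local Notation C := (pcomm p F).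

Lemma p_normal_ker (gT : finGroupType) (f : F -> gT) : {morph f : x y / x * y} ->
  p.-nat #|hom_img f| -> p_normal p [set x | f x = 1].
Proof.
move=> fM pf; split; last by exists #|hom_img f| => //; exact: hom_ker_index.
have f1 : f 1 = 1 by apply: (mulgI (f 1)); rewrite -fM !mulg1.
split=> //; first exact: hom_ker_subgroup.
by move=> n x /= fn _; rewrite conjgE !fM fn mul1g -fM mulVg.
Qed.

(** The kernel of a homomorphism [F -> Z/p].  The span of any cover is a preimage
    of it under a homomorphism into [F], and thus p-open. *)
Lemma p_open_cyclic : exists W : set F, [/\ p_open_subgroup p W,
  W (x0 None ^+ p) & forall i, 0 < i < p -> ~ W (x0 None ^+ i)].
Proof.
pose c (k : option 'I_m.+1) : 'I_p := if k is Some _ then Zp0 else Zp1.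
pose chi : F -> 'I_p := tmap x0 c.
have chiM : {morph chi : x y / x * y}.
  by move=> x y; apply: tmapM; rewrite ?x0_span.
have chiX i : chi (x0 None ^+ i) = inZp i.
  rewrite -[x0 None ^+ i](ev_nseq x0 None false) /chi tmap_ev // ev_nseq /lev /= Zp_expg.
  have -> : (val (@Zp1 q.+1) * i)%N = i by rewrite /= modn_small // mul1n.
  by [].
have o1 : (1 : 'I_p) = inZp 0 by apply: val_inj.
exists [set x | chi x = 1]; split.
- apply/p_openP; split; first exact: hom_ker_subgroup.
  exists [set x | chi x = 1] => //; apply: p_normal_ker => //.
  have d : #|hom_img chi| %| p.
    have -> : p = #|[set: 'I_p]%G| by rewrite cardsT card_ord.
    by apply: cardSg; exact: finset.subsetT.
  by apply: (pnat_dvd d); rewrite pnat_id.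
- by rewrite /= chiX o1; apply: val_inj; rewrite /= modnn.
- move=> i /andP[i0 ip]; rewrite /= chiX o1 => /(congr1 val) /=.
  by rewrite modn_small // => e; rewrite e in i0.
Qed.

Lemma cover_pbasis (J : finType) (b : option J -> F) : pbasis p b -> pbasis p (cover q b).
Proof.
move=> [fb ob]; split; first exact: cover_free.
have [W [oW Wp Wi]] := p_open_cyclic; have [sW _] := oW.
pose c (k : option J) : F := if k is Some _ then 1 else x0 None.
have phiE L : tmap b c (ev b L) = ev c L by exact: tmap_ev.
have phiM : {in span b &, {morph tmap b c : x y / x * y}}.
  by move=> x y /set_mem sx /set_mem sy; exact: tmapM.
have o := p_open_preimage ob oW phiM.
have [so _] := o; have e : span (cover q b) = span b `&` (span b `&` tmap b c @^-1` W).
  apply: span_coverP => // [k|i ip].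
  - split; first by apply: cover_spanS; exact: span_gen.
    rewrite /= /cover /sub phiE -/(sub (cover_sub q (J := J)) c k) -/(cover q c k).
    case: k => [[j i]|]; last by rewrite coverN.
    by rewrite coverS mulg1 mulgV; exact: subgroup1.
  - move=> [_ /=]; rewrite -[b None ^+ i](ev_nseq b None false) phiE ev_nseq.
    exact: Wi.
by rewrite e setIA setIid.
Qed.

Fixpoint Jx (k : nat) : finType :=
  if k is k'.+1 then (Jx k' * 'I_p)%type else ('I_m.+1 * 'I_p)%type.

Definition bstar : option (Jx 0) -> F := cover q x0.

(** The level [k] is determined by the rank.  Bases of the same level have the
    same index type, and are carried to each other by the commensurator. *)
Fixpoint reach (k : nat) : (option (Jx k) -> F) -> Prop :=
  match k with
  | 0 => fun b => nequiv bstar b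
  | k'.+1 => fun b => exists2 b0, reach b0 & nequiv (cover q b0) b
  end.

Lemma reach_nequiv k (b b' : option (Jx k) -> F) : nequiv b b' -> reach b -> reach b'.
Proof.
case: k b b' => [|k] b b' bb'; first by move=> h; exact: nequiv_trans h bb'.
by move=> [b0 r0 h]; exists b0 => //; exact: nequiv_trans h bb'.
Qed.

Lemma nequiv_pbasis (I : finType) (b b' : I -> F) : nequiv b b' -> pbasis p b -> pbasis p b'.
Proof. by move=> bb' [fb ob]; split; [exact: nequiv_free fb|rewrite -(nequiv_span bb')]. Qed.

Lemma bstar_pbasis : pbasis p bstar.
Proof. by apply: cover_pbasis; split=> //; rewrite x0_span; exact: p_openT. Qed.

Lemma reach_pbasis k (b : option (Jx k) -> F) : reach b -> pbasis p b.
Proof.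
elim: k b => [|k IH] b; first by move=> /nequiv_pbasis; apply; exact: bstar_pbasis.
by move=> [b0 /IH pb0 /nequiv_pbasis]; apply; exact: cover_pbasis.
Qed.

Lemma reach_cover k (b : option (Jx k) -> F) : reach b -> @reach k.+1 (cover q b).
Proof. by move=> rb; exists b => //; exact: nequiv_refl. Qed.

Lemma reach_span k (b : option (Jx k) -> F) : reach b -> span b `<=` span bstar.
Proof.
elim: k b => [|k IH] b; first by move=> /nequiv_span <-.
move=> [b0 /IH sb /nequiv_span <-]; apply: subset_trans sb; exact: cover_spanS.
Qed.

Lemma card_Jx_lt k : #|Jx k| < #|Jx k.+1|.
Proof.
have J0 : 0 < #|Jx k|.
  elim: k => [|k IH]; first by rewrite /= card_prod !card_ord.
  by rewrite /= card_prod card_ord muln_gt0 IH.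
by rewrite /= card_prod card_ord -[X in X < _]muln1 ltn_pmul2l.
Qed.

Lemma card_Jx_inj k l : #|Jx k| = #|Jx l| -> k = l.
Proof.
have lt := homo_ltn ltn_trans card_Jx_lt.
by case: (ltngtP k l) => // /lt h e; rewrite e ltnn in h.
Qed.

End Reach.

(** Counting the homomorphisms to a group of order two shows that the rank is
    an invariant. *)
Lemma rank_le (I I' : finType) (G : groupType) (b : I -> G) (b' : I' -> G) :
  free_tuple b -> span b = span b' -> #|I| <= #|I'|.
Proof.
move=> fb e.
have /choice[w wE] : forall i', exists L, ev b L = b' i'.
  by move=> i'; have : span b (b' i') by rewrite e; exact: span_gen.
have /choice[u uE] : forall i, exists L, ev b' L = b i.
  by move=> i; have : span b' (b i) by rewrite -e; exact: span_gen.
pose gT : groupType := {perm 'I_2}.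
pose Th (h : {ffun I -> {perm 'I_2}}) : {ffun I' -> {perm 'I_2}} :=
  [ffun i' => @ev I gT h (w i')].
have inj : injective Th.
  have rec (h : {ffun I -> {perm 'I_2}}) i : h i = @ev I' gT (Th h) (u i).
    have -> : @ev I' gT (Th h) (u i) = @ev I' gT (sub w (G := gT) h) (u i).
      by congr ev; apply/funext => i'; rewrite ffunE.
    rewrite ev_sub -[LHS](@ev1 I gT h (i, false)); apply: (free_tuple_eq _ fb).
    rewrite ev1 -ev_sub -[LHS]uE; congr ev; apply/funext => i'; exact/esym/wE.
  by move=> h h' hh; apply/ffunP => i; rewrite rec hh -rec.
have := leq_card _ inj; rewrite !card_ffun.
have -> : #|{: {perm 'I_2}}| = 2.
  exact: card_Sn.
by rewrite leq_exp2l.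
Qed.

(** * Every p-open subgroup is reached *)

Section HomImage.
Local Open Scope group_scope.
Variables (G : groupType) (gT : finGroupType) (f : G -> gT).
Hypothesis fM : {morph f : x y / x * y}.
Variable W : set G.
Hypothesis sW : subgroup W.

Definition himg := [set y : gT | `[< exists2 x, W x & f x = y >]]%SET.

Lemma himg_group_set : group_set himg.
Proof.
have f1 : f 1 = 1 by apply: (mulgI (f 1)); rewrite -fM !mulg1.
apply/group_setP; split.
  by rewrite !inE; exists 1; [exact: subgroup1|].
move=> u v; rewrite !inE => -[x Wx <-] [y Wy <-].
by exists (x * y); [exact: subgroupM|exact: fM].
Qed.

Definition himg_group := Group himg_group_set.

Lemma mem_himg x : W x -> f x \in himg.
Proof. by move=> Wx; rewrite !inE; exists x. Qed.

Lemma himg_sub (M : {group gT}) : (forall x, W x -> f x \in M) -> himg \subset M.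
Proof. by move=> WM; apply/fintype.subsetP => y; rewrite !inE => -[x /WM fx <-]. Qed.

Lemma himg_mem y : y \in himg -> exists2 x, W x & f x = y.
Proof. by rewrite !inE. Qed.

End HomImage.

Section ReachOpen.
Local Open Scope group_scope.
Local Open Scope quotient_scope.
Variables (q m : nat).
Local Notation p := q.+2.
Hypothesis p_prime : prime p.
Variables (F : groupType) (x0 : option 'I_m.+1 -> F).
Hypotheses (x0_free : free_tuple x0) (x0_span : span x0 = setT).
Local Notation reach k := (@reach q m F x0 k).
Local Notation bstar := (@bstar q m F x0).
Local Notation Jx := (Jx q m).

(** Nielsen moves bring all entries but one into the preimage of [M] and leave
    at [None] an entry that generates [P] modulo [M]; the preimage of [M] is
    then spanned by the cover. *)
Lemma reach_step k (b : option (Jx k) -> F) (gT : finGroupType) (f : F -> gT)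
    (P M : {group gT}) : {morph f : x y / x * y} ->
    reach k b -> himg f (span b) = P -> M <| P -> #|P : M| = p ->
  exists2 b' : option (Jx k.+1) -> F, reach k.+1 b' & span b' = span b `&` [set x | f x \in M].
Proof.
move=> fM rb eP nMP iMP; have [sMP nMP'] := andP nMP.
have f1 : f 1 = 1 by apply: (mulgI (f 1)); rewrite -fM !mulg1.
have fV x : f x^-1 = (f x)^-1 by apply: (mulgI (f x)); rewrite -fM !mulgV.
have fX x i : f (x ^+ i) = f x ^+ i.
  by elim: i => [|i IH]; rewrite ?expg0 // !expgS fM IH.
have sfM : subgroup [set x | f x \in M].
  apply/subgroupP; split=> /= [|x y fx fy]; first by rewrite f1 group1.
  by rewrite fM fV groupM // groupV.
have bP i : f (b i) \in P by rewrite -eP; apply: mem_himg; exact: span_gen.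
have [k0 bk0] : exists k0, f (b k0) \notin M.
  apply: contrapT => h.
  have : P \subset M.
    rewrite -eP; apply: himg_sub; apply: (span_min sfM) => i /=.
    by apply: contrapT => ?; apply: h; exists i; apply/negP.
  by rewrite -indexg_eq1 iMP.
pose b1 := b \o tperm None k0.
have rb1 : reach k b1 by apply: reach_nequiv rb; exact: nequiv_tperm.
have b1P i : f (b1 i) \in P by exact: bP.
pose X := f (b1 None).
have XM : X \notin M by rewrite /X /b1 /= tpermL.
have cP : #|P / M| = p by rewrite card_quotient.
have XN : X \in 'N(M) by apply: (fintype.subsetP nMP'); exact: b1P.
have oX : #[coset M X] = p.
  have : #[coset M X] %| p by rewrite -cP; apply: order_dvdG; apply: mem_quotient; exact: b1P.
  move/(prime_nt_dvdP p_prime); apply; rewrite order_eq1.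
  by apply: contra XM => /eqP; exact: coset_idr.
have genX : P / M = <[coset M X]>.
  apply/esym/eqP; rewrite eqEcard cP -orderE oX leqnn andbT cycle_subG.
  exact/mem_quotient/b1P.
have XiM i : (X ^+ i \in M) = (p %| i).
  rewrite -oX order_dvdn -morphX //; apply/idP/eqP; first by move=> h; exact: coset_id.
  by apply: coset_idr; exact: groupX.
have /choice[e eE] : forall j : Jx k, exists n, f (b1 (Some j)) * X ^- n \in M.
  move=> j; have : coset M (f (b1 (Some j))) \in <[coset M X]>.
    by rewrite -genX; apply: mem_quotient; exact: b1P.
  have jN : f (b1 (Some j)) \in 'N(M) by apply: (fintype.subsetP nMP'); exact: b1P.
  move=> /cycleP[n en]; exists n; apply: coset_idr; first by rewrite groupM ?groupV ?groupX.
  rewrite morphM ?groupV ?groupX // morphV ?groupX // morphX //.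
  by rewrite [X in X * _]en mulgV.
pose b2 (i : option (Jx k)) : F := if i is Some j then b1 (Some j) * b1 None ^- e j else b1 None.
have b12 : nequiv b1 b2.
  left; apply: (@tequiv_block _ _ (fun i => isSome i)) => [[j|]|[j|]] // _.
  exists [::], (nseq (e j) (None, true)); split=> //.
    by rewrite all_nseq orbT.
  by rewrite mul1g ev_nseq /lev /= expVgn.
have rb2 := reach_nequiv b12 rb1.
exists (cover q b2); first exact: reach_cover.
have -> : span b = span b2.
  rewrite -(nequiv_span b12); apply: nequiv_span; exact: nequiv_tperm.
apply: span_coverP => // [[[j i]|]|i /andP[i0 ip]] /=.
- have -> : cover q b2 (Some (j, i)) = b2 (Some j) ^ (b2 None ^- i).
    by rewrite coverS conjgE invgK -[LHS]mulgA.
  rewrite conjgE !(fM, fV, fX) -conjgE memJ_norm; first exact: eE.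
  by rewrite groupV groupX.
- by rewrite coverN fX XiM.
- by rewrite fX XiM => /(dvdn_leq i0); rewrite leqNgt ip.
Qed.

(** Descend from [span bstar] to [U] through subgroups that are maximal in the
    previous one; modulo a normal subgroup contained in [U], this takes place
    in a finite p-group, where maximal subgroups are normal of index [p]. *)
Lemma reach_open (U : set F) : p_open_subgroup p U -> U `<=` span bstar ->
  exists k (b : option (Jx k) -> F), reach k b /\ span b = U.
Proof.
move=> oU Ub; have /p_openP[sU [N pN NU]] := oU.
have [[sN _ nN] [i pi Ni]] := pN.
have fN : finite_set (left_cosets N) by exists i.
have [gT [f [fM fE]]] := coset_perm_rep sN fN.
have kerE x : f x = 1 <-> N x.
  split; first by move/fE/(_ 1); rewrite conjg1.
  by move=> Nx; apply/fE => t; exact: nN.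
have NE : N = [set x | f x = 1] by apply/seteqP; split=> x /= /kerE.
have iE : i = #|hom_img f|.
  apply/card_eq_II; apply: card_eq_trans (hom_ker_index fM).
  by rewrite -NE card_eq_sym.
have pG : p.-group (hom_img_group fM) by rewrite /pgroup /= -iE.
have H n : forall k (b : option (Jx k) -> F), reach k b -> U `<=` span b ->
    #|himg f (span b)| <= n -> exists k (b : option (Jx k) -> F), reach k b /\ span b = U.
  elim: n => [|n IH] k b rb Usb le.
    have := cardG_gt0 (himg_group fM (span_subgroup b)).
    by rewrite /= ltnNge le.
  have [bU|bU] := pselect (span b `<=` U).
    by exists k, b; split=> //; apply/seteqP.
  pose P := himg_group fM (span_subgroup b); pose Q := himg_group fM sU.
  have QP : Q \subset P by apply: himg_sub => x /Usb; exact: mem_himg.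
  have pP : p.-group P.
    by apply: pgroupS pG; apply: himg_sub => x _; exact: mem_hom_img.
  have [eQP|[M maxM QM]] := maximal_exists QP.
    exfalso; apply: bU => x bx.
    have : f x \in Q by rewrite [Q : {set gT}]eQP; exact: mem_himg.
    move=> /himg_mem[u Uu fu]; rewrite -[x](mulVKg u); apply: subgroupM => //.
    apply: NU; apply/kerE; rewrite fM -fu -fM mulVg.
    by apply: (mulgI (f 1)); rewrite -fM !mulg1.
  have [b' rb' eb'] := reach_step fM rb (erefl : himg f (span b) = P)
    (p_maximal_normal pP maxM) (p_maximal_index pP maxM).
  apply: (IH _ b' rb').
    rewrite eb' => x Ux; split; first exact: Usb.
    by apply: (fintype.subsetP QM); exact: mem_himg.
  rewrite -ltnS; apply: leq_trans le; apply: leq_ltn_trans (_ : #|M| < _).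
    by apply: subset_leq_card; apply: himg_sub => x; rewrite eb' => -[].
  exact: proper_card (maxgroupp maxM).
by apply: (H _ 0 bstar); [exact: nequiv_refl| |exact: leqnn].
Qed.

(** The rank determines the level, and by Nielsen's theorem any two bases of the
    same subgroup are equivalent. *)
Lemma reach_basis k (b : option (Jx k) -> F) :
  pbasis p b -> span b `<=` span bstar -> reach k b.
Proof.
move=> [fb ob] sb; have [l [b' [rb' eb']]] := reach_open ob sb.
have [fb' _] := reach_pbasis p_prime x0_free x0_span rb'.
have e : k = l.
  apply: (@card_Jx_inj q m); apply: succn_inj; rewrite -!card_option.
  by apply/eqP; rewrite eqn_leq (rank_le fb (esym eb')) (rank_le fb' eb').
subst l; apply: reach_nequiv rb'.
exact: nielsen.
Qed.

(** Shrink the domain until both it and its image lie in [span bstar]. *)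
Lemma pcomm_carries (c : pcomm p F) :
  exists k (b b' : option (Jx k) -> F), [/\ reach k b, reach k b' & carries c b b'].
Proof.
elim/quotW: c => f.
have [_ os] := bstar_pbasis p_prime x0_free x0_span.
have oU : p_open_subgroup p (pdom f `&` f @^-1` span bstar `&` span bstar).
  apply: p_openI => //; apply: p_open_preimage => //; [exact: pdom_open|exact: pfunM].
have [|k [b [rb eb]]] := reach_open oU; first by move=> x [].
have cb : carries (\pi_(pcomm p F) f) b (f \o b).
  by exists f; split=> //; rewrite eb => x [[]].
exists k, b, (f \o b); split=> //; apply: reach_basis.
  by apply: carries_pbasis cb _; exact: reach_pbasis rb.
apply: span_min; first exact: span_subgroup.
by move=> i; have : span b (b i) by [exact: span_gen]; rewrite eb => -[[]].
Qed.

End ReachOpen.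

(** * The subgroup generated by the transvections *)

Section Transvections.
Local Open Scope group_scope.
Local Open Scope quotient_scope.
Variables (q m : nat).
Local Notation p := q.+2.
Hypothesis p_prime : prime p.
Variables (F : groupType) (x0 : option 'I_m.+1 -> F).
Hypotheses (x0_free : free_tuple x0) (x0_span : span x0 = setT).
Local Notation C := (pcomm p F).
Local Notation reach k := (@reach q m F x0 k).
Local Notation bstar := (@bstar q m F x0).
Local Notation Jx := (Jx q m).
Local Notation reach_pbasis := (reach_pbasis p_prime x0_free x0_span).

(** The simple group of the theorem. *)
Inductive elem : C -> Prop :=
| elem1 : elem 1
| elem_gen k (b : option (Jx k) -> F) i j c :
    reach k b -> i != j -> carries c b (rmul i (j, false) b) -> elem c
| elemM c d : elem c -> elem d -> elem (c * d)
| elemV c : elem c -> elem c^-1.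

Lemma elem_subgroup : subgroup elem.
Proof.
apply/subgroupP; split; first exact: elem1.
by move=> x y ex ey; apply: elemM => //; exact: elemV.
Qed.

Lemma reach_carries k (b b' : option (Jx k) -> F) : reach k b -> reach k b' ->
  exists c : C, carries c b b'.
Proof. by move=> rb rb'; apply: carries_exists; exact: reach_pbasis. Qed.

Lemma reach_uniq k (b b' : option (Jx k) -> F) (c d : C) : reach k b ->
  carries c b b' -> carries d b b' -> c = d.
Proof. by move=> /reach_pbasis[_ ob]; exact: carries_uniq. Qed.

Lemma reach_tequiv k (b b' : option (Jx k) -> F) : tequiv b b' -> reach k b -> reach k b'.
Proof. by move=> bb'; apply: reach_nequiv; left. Qed.

Lemma reach_rmul k (b : option (Jx k) -> F) i l : l.1 != i -> reach k b -> reach k (rmul i l b).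
Proof.
by move=> li; apply: reach_tequiv; apply: tequiv_rmul => //; exact: tequiv_refl.
Qed.

Lemma reach_invat k (b : option (Jx k) -> F) i : reach k b -> reach k (invat i b).
Proof. by apply: reach_nequiv; exact: nequiv_invat. Qed.

(** Left multiplications are right multiplications of the basis with one
    entry inverted. *)
Lemma carries_tequiv (K : set C) k : subgroup K ->
    (forall (b : option (Jx k) -> F) i j c, reach k b -> i != j ->
       carries c b (rmul i (j, false) b) -> K c) ->
  forall (b b' : option (Jx k) -> F) c, reach k b -> tequiv b b' -> carries c b b' -> K c.
Proof.
move=> sK Kgen; have Kr b i l c : reach k b -> l.1 != i ->
    carries c b (rmul i l b) -> K c.
  case: l => j [] rb ji cb; last by apply: Kgen rb _ cb; rewrite eq_sym.
  rewrite -[c]invgK; apply: subgroupV => //; apply: (Kgen b i j) => //.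
    by rewrite eq_sym.
  exact: (carries_rmulV (l := (j, true))).
move=> b b' c rb bb'; elim: bb' c => [|d i l bd IH li|d i l bd IH li] c cb.
- by rewrite (reach_uniq rb cb (carries1 _ b)); exact: subgroup1.
- have rd := reach_tequiv bd rb; have [c1 c1d] := reach_carries rb rd.
  have cd : carries (c * c1^-1) d (rmul i l d) by apply: carries_mul cb; exact: carries_inv.
  rewrite -[c](mulgVK c1); apply: subgroupM => //; last exact: IH.
  exact: Kr cd.
- have rd := reach_tequiv bd rb; have [c1 c1d] := reach_carries rb rd.
  have cd : carries (c * c1^-1) d (lmul i l d) by apply: carries_mul cb; exact: carries_inv.
  rewrite -[c](mulgVK c1); apply: subgroupM => //; last exact: IH.
  have /= := carries_sub (isub i) cd; rewrite -/(invat _ _) -/(invat _ _) invat_lmul //.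
  by apply: Kr => //; exact: reach_invat.
Qed.

Lemma elem_tequiv k (b b' : option (Jx k) -> F) c :
  reach k b -> tequiv b b' -> carries c b b' -> elem c.
Proof.
apply: carries_tequiv; first exact: elem_subgroup.
by move=> b0 i j c0 rb ij cb; exact: elem_gen rb ij cb.
Qed.

(** ** Inversions *)

Lemma elem_invat_indep k (b : option (Jx k) -> F) i j (c d : C) : reach k b ->
  carries c b (invat i b) -> carries d b (invat j b) -> elem (c * d^-1).
Proof.
move=> rb ci dj; have cd := carries_mul (carries_inv dj) ci.
exact: (elem_tequiv (reach_invat j rb) (tequiv_invatC j i b) cd).
Qed.

(** Both inversions act on [b]: one inverts an entry of [b], the other one an
    entry of [b'].  The difference is made up by moves from [b] to [b'], and by
    the same moves transported by the inversion [d]. *)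
Lemma elem_invat_tequiv k (b b' : option (Jx k) -> F) i (c d : C) : reach k b ->
  tequiv b b' -> carries c b (invat i b) -> carries d b' (invat i b') -> elem (c * d^-1).
Proof.
move=> rb bb' cb db'; have rb' := reach_tequiv bb' rb.
have [t tb] := reach_carries rb rb'.
have [t2 tb2] := reach_carries (reach_invat i rb) (reach_invat i rb').
have et2 := elem_tequiv (reach_invat i rb) (tequiv_invat i bb') tb2.
have [s [es sH]] := tequiv_subst (tequiv_sym bb').
have db : carries d b (sub s (invat i b')) by rewrite es; exact: carries_sub.
have cj := carries_conj db db' tb.
have edt : elem (d * t * d^-1).
  have rs : reach k (sub s (invat i b')) := reach_tequiv (sH _ _) (reach_invat i rb').
  exact: elem_tequiv rs (tequiv_sym (sH _ _)) cj.
have e : t2 * c = d * t.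
  by apply: (reach_uniq rb); [exact: carries_mul cb tb2|exact: carries_mul tb db'].
have -> : c * d^-1 = t2^-1 * (d * t * d^-1) by rewrite -e -mulgA mulKg.
by apply: elemM => //; exact: elemV.
Qed.

Lemma elem_invat_nequiv k (b b' : option (Jx k) -> F) i (c d : C) : reach k b ->
  nequiv b b' -> carries c b (invat i b) -> carries d b' (invat i b') -> elem (c * d^-1).
Proof.
move=> rb [bb'|[j bb']] cb db'; first exact: elem_invat_tequiv cb db'.
apply: (elem_invat_tequiv rb bb' cb).
by rewrite invatC; exact: carries_sub.
Qed.

Definition J0 k : Jx k := nat_rect (fun k => Jx k) (ord0, ord0) (fun k j => (j, ord0)) k.

(** An inversion lifts to [p] inversions in the cover: these amount to one
    inversion if [p] is odd, and to none if [p = 2]. *)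
Lemma elem_invat_cover k (b : option (Jx k) -> F) i i' (c d : C) : odd p -> reach k b ->
  carries c b (invat i b) -> carries d (cover q b) (invat i' (cover q b)) -> elem (c * d^-1).
Proof.
move=> op rb cb db.
have [c' cb'] := reach_carries rb (reach_invat (Some (J0 k)) rb).
have rc : reach k.+1 (cover q b) := reach_cover rb.
have e1 := elem_invat_indep rb cb cb'.
have cc := carries_sub (cover_sub q) cb'; rewrite -![sub _ _]/(cover q _) cover_invat in cc.
have cd := carries_mul (carries_inv db) cc.
have te := tequiv_invats [seq Some (J0 k, j) | j <- enum 'I_p] i' (cover q b).
rewrite size_map size_enum_ord op in te.
have e2 : elem (c' * d^-1)
  by exact: (@elem_tequiv k.+1 _ _ _ (@reach_invat k.+1 _ i' rc) (tequiv_sym te) cd).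
have -> : c * d^-1 = (c * c'^-1) * (c' * d^-1) by rewrite mulgA mulgVK.
exact: elemM.
Qed.

Lemma elem_invat_even k (b : option (Jx k) -> F) i (c : C) : ~~ odd p -> reach k b ->
  carries c b (invat i b) -> elem c.
Proof.
move=> op rb cb.
have [c' cb'] := reach_carries rb (reach_invat (Some (J0 k)) rb).
have rc : reach k.+1 (cover q b) := reach_cover rb.
have e1 := elem_invat_indep rb cb cb'.
have cc := carries_sub (cover_sub q) cb'; rewrite -![sub _ _]/(cover q _) cover_invat in cc.
have te := tequiv_invats [seq Some (J0 k, j) | j <- enum 'I_p] None (cover q b).
rewrite size_map size_enum_ord (negPf op) in te.
have e2 : elem c' by exact: (@elem_tequiv k.+1 _ _ _ rc (tequiv_sym te) cc).
by rewrite -[c](mulgVK c'); exact: elemM.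
Qed.

Lemma bstar_reach : reach 0 bstar. Proof. exact: nequiv_refl. Qed.

(** Represents the other coset of [elem], if there is one. *)
Definition io : C := xget 1 [set c | carries c bstar (invat None bstar)].

Lemma ioP : carries io bstar (invat None bstar).
Proof.
have [c cb] := reach_carries bstar_reach (reach_invat None bstar_reach).
by apply: (@xgetPex _ 1 [set c | carries c bstar (invat None bstar)]); exists c.
Qed.

Lemma ioV : io^-1 = io.
Proof.
apply: (mulIg io); rewrite mulVg; apply: (reach_uniq bstar_reach (carries1 _ _)).
apply: (carries_mul ioP); rewrite -{2}(invatK None bstar).
by apply: (@carries_sub _ _ _ _ _ _ _ (isub None)); exact: ioP.
Qed.

Lemma elem_invat k (b : option (Jx k) -> F) i (c : C) : reach k b ->
  carries c b (invat i b) -> elem (c * io).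
Proof.
have [op|op] := boolP (odd p); last first.
  move=> rb cb; apply: elemM; first exact: elem_invat_even cb.
  exact: (elem_invat_even op bstar_reach ioP).
rewrite -ioV; elim: k b i c => [|k IH] b i c rb cb.
  have [c1 cb1] := reach_carries rb (reach_invat None rb).
  have -> : c * io^-1 = (c * c1^-1) * (c1 * io^-1) by rewrite mulgA mulgVK.
  apply: elemM; first exact: elem_invat_indep cb cb1.
  by apply: (elem_invat_nequiv rb _ cb1 ioP); exact: nequiv_sym.
have [b0 rb0 eb] := rb; have rc0 : reach k.+1 (cover q b0) := reach_cover rb0.
have [d db] := reach_carries rc0 (reach_invat i rc0).
have [e eb0] := reach_carries rb0 (reach_invat None rb0).
have -> : c * io^-1 = (c * d^-1) * (e * d^-1)^-1 * (e * io^-1).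
  by rewrite invgM invgK !mulgA !mulgVK.
apply: elemM; last exact: IH eb0.
apply: elemM; first by apply: (elem_invat_nequiv rb _ cb db); exact: nequiv_sym.
by apply: elemV; exact: (elem_invat_cover op rb0 eb0 db).
Qed.

(** [io] may be replaced by an inversion of an entry of the basis of the given
    transvection; the conjugate is then a transvection of the inverted basis. *)
Lemma elem_io c : elem c -> elem (io * c * io).
Proof.
have ioio : io * io = 1 by rewrite -{1}ioV mulVg.
elim=> [|k b i j d rb ij db|d e _ IHd _ IHe|d _ IHd].
- by rewrite mulg1 ioio; exact: elem1.
- have [e eb] := reach_carries rb (reach_invat None rb).
  have e1 := elem_invat rb eb.
  have e2 : elem (e * d * e^-1).
    apply: (elem_gen (reach_invat None rb) ij).
    by apply: (carries_conj eb _ db); exact: carries_sub.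
  have -> : io * d * io = (e * io)^-1 * (e * d * e^-1) * (e * io).
    by rewrite invgM ioV !mulgA !mulgVK.
  by apply: elemM => //; apply: elemM => //; exact: elemV.
- have -> : io * (d * e) * io = (io * d * io) * (io * e * io).
    by rewrite -!mulgA (mulgA io io) ioio mul1g.
  exact: elemM.
- have -> : io * d^-1 * io = (io * d * io)^-1 by rewrite !invgM ioV mulgA.
  exact: elemV.
Qed.

Lemma ioK c : c * io * io = c.
Proof. by rewrite -{2}ioV mulgK. Qed.

(** ** The index *)

Definition elem_ext : set C := [set c | elem c \/ elem (c * io)].

Lemma elem_ext_subgroup : subgroup elem_ext.
Proof.
have V c : elem_ext c -> elem_ext c^-1.
  case=> [ec|/elemV/elem_io]; first by left; exact: elemV.
  by rewrite invgM ioV -{1}ioV mulKg => h; right.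
apply/subgroupP; split; first by left; exact: elem1.
move=> x y ex /V; move: (y^-1) => {}y ey; case: ex ey => [ex|ex] [ey|ey].
- by left; exact: elemM.
- by right; rewrite -mulgA; exact: elemM.
- right; have -> : x * y * io = (x * io) * (io * y * io).
    by rewrite !mulgA ioK.
  by apply: elemM => //; exact: elem_io.
- left; have -> : x * y = (x * io) * (io * (y * io) * io).
    by rewrite !mulgA !ioK.
  by apply: elemM => //; exact: elem_io.
Qed.

Lemma elem_ext_nequiv k (b b' : option (Jx k) -> F) (c : C) :
  reach k b -> nequiv b b' -> carries c b b' -> elem_ext c.
Proof.
move=> rb bb' cb; have rb' := reach_nequiv bb' rb.
case: bb' => [bb'|[i bb']]; first by left; exact: elem_tequiv cb.
have [d db] := reach_carries rb' (reach_invat i rb').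
have ed : elem_ext d by right; exact: elem_invat db.
have edc : elem_ext (d * c) by left; exact: (elem_tequiv rb bb' (carries_mul cb db)).
rewrite -[c](mulKg d); apply: (subgroupM elem_ext_subgroup) => //.
exact: (subgroupV elem_ext_subgroup).
Qed.

(** Two bases of the same level come, up to Nielsen moves, from covers of bases of
    the previous level, and an element carrying the latter to each other also
    carries their covers to each other. *)
Lemma elem_ext_reach k (b b' : option (Jx k) -> F) (c : C) :
  reach k b -> reach k b' -> carries c b b' -> elem_ext c.
Proof.
elim: k b b' c => [|k IH] b b' c rb rb' cb.
  apply: (elem_ext_nequiv rb _ cb).
  by apply: nequiv_trans rb'; exact: nequiv_sym.
have [b0 rb0 eb] := rb; have [b0' rb0' eb'] := rb'.
have rc : reach k.+1 (cover q b0) := reach_cover rb0.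
have rc' : reach k.+1 (cover q b0') := reach_cover rb0'.
have [e e0] := reach_carries rb0 rb0'.
have ec : carries e (cover q b0) (cover q b0') := carries_sub _ e0.
have [t tb] := reach_carries rc rb; have [t' tb'] := reach_carries rc' rb'.
have -> : c = t' * e * t^-1.
  apply: (reach_uniq rb cb); apply: (carries_mul (carries_inv tb)).
  exact: carries_mul ec tb'.
have sE := elem_ext_subgroup.
apply: subgroupM => //; first apply: subgroupM => //.
- exact: (@elem_ext_nequiv k.+1 _ _ _ rc' eb' tb').
- exact: IH e0.
- by apply: subgroupV => //; exact: (@elem_ext_nequiv k.+1 _ _ _ rc eb tb).
Qed.

Lemma elem_extT c : elem_ext c.
Proof.
have [k [b [b' [rb rb' cb]]]] := pcomm_carries p_prime x0_free x0_span c.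
exact: elem_ext_reach cb.
Qed.

Lemma elem_index : left_cosets elem #<= `I_2.
Proof.
have sE := elem_subgroup.
pose f (A : set C) : nat := ~~ `[< A 1 >].
have f1 x : f (left_coset x elem) = ~~ `[< elem x >].
  congr (nat_of_bool (~~ _)); apply: asbool_equiv_eq; split.
    move=> [h eh hx]; have -> : x = h^-1 by rewrite -[h^-1]mul1g -hx mulgK.
    exact: elemV.
  by move=> ex; exists x^-1; [exact: elemV|rewrite mulgV].
have finj : {in left_cosets elem &, injective f}.
  move=> _ _ /set_mem[x _ <-] /set_mem[y _ <-]; rewrite !f1 => e.
  apply/(Defs.lcoset_eqP x y sE).
  have : `[< elem x >] = `[< elem y >] by move: e; do 2 case: asbool.
  case: asboolP => ex => [/esym/asboolP ey|/esym/negbT/asboolPn ey].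
    by apply: elemM => //; exact: elemV.
  have [//|exi] := elem_extT x; have [//|eyi] := elem_extT y.
  have -> : x^-1 * y = io * ((x * io)^-1 * (y * io)) * io.
    by rewrite invgM ioV !mulgA ioK -{1}ioV mulVg mul1g.
  by apply: elem_io; apply: elemM => //; exact: elemV.
rewrite -(card_le_eql (inj_card_eq finj)); apply: subset_card_le => _ [_ [x _ <-] <-].
by rewrite f1 /=; case: asbool.
Qed.

End Transvections.

(** * Words and letter counts under change of basis *)

Section WordOps.
Local Open Scope group_scope.
Variable I : finType.
Implicit Types (L : word I) (x y z : I).

Definition lmap (s : {perm I}) L : word I := [seq (s l.1, l.2) | l <- L].

Lemma ev_lmap (G : groupType) (b : I -> G) (s : {perm I}) L : ev (b \o s) L = ev b (lmap s L).
Proof. by elim: L => [|l L IH] //=; rewrite -IH. Qed.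

Lemma lmap_tperm (G : groupType) (b : I -> G) x y L :
  ev (b \o tperm x y) (lmap (tperm x y) L) = ev b L.
Proof.
rewrite ev_lmap /lmap -map_comp; congr ev.
by rewrite -[RHS]map_id; apply: eq_map => -[i e]; rewrite /= tpermK.
Qed.

Lemma wc_lmap (s : {perm I}) e z L : wc e (s z) (lmap s L) = wc e z L.
Proof.
by elim: L => [|l L IH] //; rewrite /= !wc_cons IH /= (inj_eq perm_inj).
Qed.

Lemma occ_lmap (s : {perm I}) z L : occ (s z) (lmap s L) = occ z L.
Proof.
by elim: L => [|l L IH] //; rewrite /= !occ_cons IH /= (inj_eq perm_inj).
Qed.

Lemma size_lmap s L : size (lmap s L) = size L.
Proof. exact: size_map. Qed.

Lemma balanced_lmap n (s : {perm I}) z L : balanced n (s z) (lmap s L) = balanced n z L.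
Proof. by rewrite /balanced !wc_lmap. Qed.

Lemma wc_cat e z L L' : wc e z (L ++ L') = (wc e z L + wc e z L')%N.
Proof. exact: count_cat. Qed.

Lemma occ_cat z L L' : occ z (L ++ L') = (occ z L + occ z L')%N.
Proof. exact: count_cat. Qed.

Lemma wc_winv e z L : wc e z (winv L) = wc (~~ e) z L.
Proof.
rewrite /wc /winv count_rev count_map; apply: eq_count => l /=.
by case: l.2; case: e.
Qed.

Lemma occ_winv z L : occ z (winv L) = occ z L.
Proof. by rewrite /occ /winv count_rev count_map. Qed.

Lemma wc_rsub e x y z L : x != y ->
  wc e z (wsub (rsub y (x, false)) L) = (wc e z L + (z == x) * wc e y L)%N.
Proof.
move=> xy; elim: L => [|[i f] L IH]; first by rewrite muln0.
have -> : wsub (rsub y (x, false)) ((i, f) :: L) =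
  (if f then winv (rsub y (x, false) i) else rsub y (x, false) i)
    ++ wsub (rsub y (x, false)) L by [].
rewrite wc_cat IH !wc_cons mulnDr /=.
have -> : wc e z (if f then winv (rsub y (x, false) i) else rsub y (x, false) i)
   = ((i == z) && (f == e) + (z == x) * ((i == y) && (f == e)))%N.
  rewrite /rsub {IH}; case: (i == y); case: f => /=;
  by rewrite /winv /= !wc_cons /wc /= ?[x == z]eq_sym; case: (i == z); case: (z == x); case: e.
lia.
Qed.

Lemma wc_nseq e z n x f : wc e z (nseq n (x, f)) = (((x == z) && (f == e)) * n)%N.
Proof. by rewrite /wc count_nseq. Qed.

Lemma occ_nseq z n x f : occ z (nseq n (x, f)) = ((x == z) * n)%N.
Proof. by rewrite /occ count_nseq. Qed.

Lemma perm_move2 x y x' y' : x != y -> x' != y' -> exists s : {perm I}, s x = x' /\ s y = y'.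
Proof.
move=> xy xy'; exists (tperm x x' * tperm (tperm x x' y) y'); rewrite !permM tpermL tpermL.
split=> //; apply: tpermD; last by rewrite eq_sym.
apply: contra xy => /eqP h.
by rewrite -(inj_eq (@perm_inj _ (tperm x x'))) h tpermL.
Qed.

End WordOps.

(** * Simplicity *)

Section Simplicity.
Local Open Scope group_scope.
Variables (q m : nat).
Local Notation p := q.+2.
Hypothesis p_prime : prime p.
Variables (F : groupType) (x0 : option 'I_m.+1 -> F).
Hypotheses (x0_free : free_tuple x0) (x0_span : span x0 = setT).
Local Notation C := (pcomm p F).
Local Notation reach k := (@reach q m F x0 k).
Local Notation bstar := (@bstar q m F x0).
Local Notation Jx := (Jx q m).
Local Notation reach_pbasis := (reach_pbasis p_prime x0_free x0_span).
Local Notation reach_carries := (reach_carries p_prime x0_free x0_span).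
Local Notation reach_uniq := (reach_uniq p_prime x0_free x0_span).
Local Notation elem := (@elem q m F x0).
Local Notation io := (@io q m F x0).
Local Notation ioV := (ioV p_prime x0_free x0_span).
Local Notation elem_tequiv := (elem_tequiv p_prime x0_free x0_span).
Local Notation elem_invat := (elem_invat p_prime x0_free x0_span).
Local Notation elem_io := (elem_io p_prime x0_free x0_span).
Local Notation ioK := (ioK p_prime x0_free x0_span).
Local Notation elem_extT := (elem_extT p_prime x0_free x0_span).
Local Notation carries_tequiv := (carries_tequiv p_prime x0_free x0_span).

Lemma tequiv_conj (I : finType) (b : I -> F) i : tequiv b (conj_fun (b i) \o b).
Proof.
apply: (@tequiv_block _ _ (fun k => k != i)) => k; rewrite ?negbK.
  by move=> /eqP-> /=; rewrite /conj_fun mulgK.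
move=> ki; exists [:: (i, false)], [:: (i, true)]; split; rewrite /= ?negbK ?eqxx //.
by rewrite /conj_fun /lev /= !mulg1.
Qed.

Lemma elem_inn w : span bstar w -> elem (inn p w).
Proof.
suff H : span bstar `<=` [set w | elem (inn p w)] by exact: H.
apply: span_min.
  apply/subgroupP; split=> /=; first by rewrite inn1; exact: elem1.
  by move=> x y ex ey; rewrite innM innV; apply: elemM => //; exact: elemV.
move=> i; apply: (elem_tequiv (bstar_reach q x0) (tequiv_conj bstar i)).
exact: carries_inn.
Qed.

Lemma Jx_neq k : exists j l : Jx k, j != l.
Proof.
exists (J0 q m k), (nat_rect (fun k => Jx k) (ord0, inord 1) (fun k j => (j, inord 1)) k).
have n : ord0 != inord 1 :> 'I_p by rewrite -val_eqE /= inordK.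
by case: k => [|k] /=; rewrite xpair_eqE negb_and n orbT.
Qed.

Section Normal.
Variable N : set C.
Hypotheses (nN : normal_in N elem).

Let sN : subgroup N. Proof. by case: nN. Qed.

Lemma normal_conj n x : N n -> elem x -> N (x * n * x^-1).
Proof.
move=> Nn ex; case: nN => _ _ /(_ n x^-1 Nn (elemV ex)).
by rewrite conjgE invgK mulgA.
Qed.

Lemma normal_comm n x : N n -> elem x -> N (n * x * n^-1 * x^-1).
Proof.
move=> Nn ex; have -> : n * x * n^-1 * x^-1 = n * (x * n^-1 * x^-1) by rewrite !mulgA.
by apply: subgroupM => //; apply: normal_conj => //; exact: subgroupV.
Qed.

Definition level k : Prop := forall (b : option (Jx k) -> F) i j c,
  reach k b -> i != j -> carries c b (rmul i (j, false) b) -> N c.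

(** If [g] carries the basis of the given transvection to another one, then [g]
    or its product with the inversion of a third entry lies in [elem]; both
    conjugate the transvection to the same transvection of the other basis. *)
Lemma level_one k (b : option (Jx k) -> F) a t c : reach k b -> a != t ->
  carries c b (rmul a (t, false) b) -> N c -> level k.
Proof.
move=> rb at_ cb Nc b0 i j c' rb0 ij cb0.
have [s [sa st]] := perm_move2 at_ ij.
pose b' := b0 \o s.
have rb' : reach k b' by apply: reach_nequiv rb0; exact: nequiv_perm.
have cb' : carries c' b' (rmul a (t, false) b').
  have -> : rmul a (t, false) b' = rmul i (j, false) b0 \o s.
    apply/funext => k0; rewrite /= !rmulE /= -sa (inj_eq perm_inj).
    by rewrite /lev /= /b' /= st.
  exact: carries_reindex.
have [g gb] := reach_carries rb rb'.
have conj_ok h b2 : elem h -> carries h b b2 -> carries c' b2 (rmul a (t, false) b2) -> N c'.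
  move=> eh hb cb2; have -> : c' = h * c * h^-1; last exact: normal_conj.
  have rb2 : p_open_subgroup p (span b2) by exact: (carries_pbasis hb (reach_pbasis rb)).2.
  apply: (carries_uniq rb2 cb2).
  by apply: (carries_conj hb _ cb); exact: carries_sub.
have [eg|eg] := elem_extT g; first exact: conj_ok gb cb'.
have [z [za zt]] : exists z, z != a /\ z != t.
  have [u [v uv]] := Jx_neq k.
  have [h1|h1] := boolP ((None != a) && (None != t)).
    by move: h1 => /andP[]; exists None.
  have [h2|h2] := boolP ((Some u != a) && (Some u != t)).
    by move: h2 => /andP[]; exists (Some u).
  exists (Some v); move: h1 h2 at_; rewrite !negb_and !negbK.
  by case/orP => /eqP <-; case/orP => /eqP <- //=; rewrite ?eqxx //= => _;
    rewrite eq_sym // (inj_eq (@Some_inj _)) eq_sym.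
have [e eb] := reach_carries rb' (reach_invat z rb').
apply: (conj_ok (e * g) (invat z b')).
- have -> : e * g = (e * io) * (io * (g * io) * io).
    by rewrite !mulgA !ioK.
  by apply: elemM; [exact: elem_invat eb|exact: elem_io].
- exact: carries_mul eb.
- by rewrite rmul_invat //; exact: carries_sub.
Qed.

(** In the cover, a transvection away from [None] becomes a product of [p]
    transvections. *)
Lemma level_down k : level k.+1 -> level k.
Proof.
move=> lv; have [j [l jl]] := Jx_neq k.
have [b rb] : exists b, reach k b.
  elim: (k) => [|n [b rb]]; first by exists bstar; exact: bstar_reach.
  by exists (cover q b); exact: reach_cover.
have rr : reach k (rmul (Some j) (Some l, false) b).
  by apply: reach_rmul => //=; rewrite (inj_eq (@Some_inj _)) eq_sym.
have [c cb] := reach_carries rb rr.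
apply: (level_one rb _ cb); first by rewrite (inj_eq (@Some_inj _)).
have te : tequiv (cover q b) (cover q (rmul (Some j) (Some l, false) b)).
  apply: (@tequiv_block _ _ (fun i => if i is Some (j', _) then j' == j else false)).
    by move=> [[j' i]|] // h; rewrite cover_rmul // (negPf h).
  move=> [[j' i]|] // h; rewrite cover_rmul // h.
  exists [::], [:: (Some (l, i), false)]; split=> //=; last by rewrite mul1g /lev /= mulg1.
  by rewrite eq_sym jl.
exact: (@carries_tequiv N k.+1 sN lv _ _ _ (reach_cover rb) te (carries_sub _ cb)).
Qed.

(** The core of the argument.  Let [w] be a word in a basis [b], without the
    letter [s], such that the exponent sum of [x = b None] is prime to [p].  In
    the cover of [b], conjugation by [w] carries the transvection
    [s_0 -> s_0 * t], where [t = x ^ p] and [s_i = x ^ i * s * x ^- i], to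
    [s_e -> s_e * t], with [e] the class of the exponent sum.  The quotient of
    the two lies in [N], and its commutator with [a -> a * s_0], where [a] is a
    further entry, is the transvection [a -> a * t^-1]. *)
Lemma level_core k (b : option (Jx k) -> F) (s : Jx k) L : reach k b ->
  N (inn p (ev b L)) -> occ (Some s) L = 0%N -> ~~ balanced p None L -> level k.+1.
Proof.
move=> rb Nw oL uL; set w := ev b L in Nw.
pose K := (Jx k * 'I_p)%type; pose B : option K -> F := cover q b.
pose S i : option K := Some (s, inord i).
have rB : reach k.+1 B := reach_cover rb.
(* [w * x ^+ i] is a word in the cover, without the letters [S _], times a power
   [f i] of [x]; modulo [p], this [f i] is [i] plus the exponent sum. *)
pose M i := L ++ nseq i (None, false); pose o i := (rw q 0 (M i)).1; pose f i := (rw q 0 (M i)).2.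
have wE i : w * b None ^+ i = ev B (o i) * b None ^+ f i.
  by rewrite -(rw_ev b (M i) (isT : 0 < p)).1 expg0 mul1g ev_cat ev_nseq.
have fp i : f i < p := (rw_ev b (M i) (isT : 0 < p)).2.
have fE i : (wc false None L + i + p * wc true None (o i) =
             wc true None L + p * wc false None (o i) + f i)%N.
  have := rw_wcN (M i) (isT : 0 < p).
  by rewrite add0n !wc_cat !wc_nseq /= mul1n mul0n addn0.
have f0 : f 0%N != 0%N.
  apply: contra uL => /eqP e; have := fE 0%N; rewrite e !addn0 => h.
  apply/eqP; have := congr1 (modn^~ p) h.
  by rewrite -![(p * _)%N]mulnC addnC modnMDl addnC modnMDl.
have fi i : 0 < i < p -> f i != f 0%N.
  move=> /andP[i0 ip]; apply/eqP => e; have h := fE i; have h0 := fE 0%N; rewrite e in h.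
  have ar (a c x y x' y' g : nat) : (a + i + x' = c + y' + g -> a + 0 + x = c + y + g ->
    i + (x' + y) = y' + x)%N by lia.
  have := ar _ _ _ _ _ _ _ h h0; rewrite -!mulnDr => /(congr1 (modn^~ p)).
  by rewrite addnC mulnC modnMDl modnMr modn_small // => i0'; rewrite i0' in i0.
pose e := f 0%N.
pose B1 := rmul (S 0%N) (None, false) B; pose B2 := rmul (S e) (None, false) B.
pose ns (i : option K) := if i is Some j then j.1 != s else true.
have B2ns v : all (fun l : letter (option K) => ns l.1) v -> ev B2 v = ev B v.
  move=> h; apply: (ev_eq_in h) => -[[j i]|] //= js; last by rewrite /B2 rmulE.
  by rewrite /B2 rmulE ifN // /S (inj_eq (@Some_inj _)) xpair_eqE negb_and js.
have ons i : all (fun l : letter (option K) => ns l.1) (o i).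
  by apply: rw_avoid; rewrite occ_cat oL occ_nseq.
(* The words [u i] express the conjugates of [B i] by [w] in [B], and also the
   conjugates of [B1 i] by [w] in [B2]. *)
pose u (i : option K) : word (option K) :=
  let v := (rw q 0 (L ++ cover_sub q i ++ winv L)).1 in
  if i is Some (j, i') then
    if j == s then o i' ++ (S (f i'), false) :: winv (o i') else v
  else v.
have vE i : ns i -> u i = (rw q 0 (L ++ cover_sub q i ++ winv L)).1.
  by case: i => [[j i]|] //= /negPf->.
have nsE i : ns i -> ev B (u i) = w * B i * w^-1 /\ ev B2 (u i) = w * B1 i * w^-1.
  move=> nsi; rewrite B2ns; last first.
    rewrite vE //; apply: rw_avoid; rewrite !occ_cat occ_winv oL.
    case: i nsi => [[j i]|_]; last by rewrite occ_nseq.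
    by rewrite /= => /negPf js; rewrite occ_cat occ_cons !occ_nseq /= (inj_eq (@Some_inj _)) js.
  have -> : B1 i = B i.
    rewrite /B1 rmulE ifN //; case: i nsi => [[j i]|] //= js.
    by rewrite (inj_eq (@Some_inj _)) xpair_eqE negb_and js.
  suff -> : ev B (u i) = w * B i * w^-1 by [].
  rewrite vE //; set V := L ++ _.
  have bal : balanced p None V.
    have c : wc false None (cover_sub q i) == wc true None (cover_sub q i) %[mod p].
      case: (i) => [[j i']|]; last by rewrite !wc_nseq /= mul1n mul0n modnn mod0n.
      by rewrite !wc_cat !wc_cons !wc_nseq /= !mul1n !mul0n !addn0 !add0n.
    rewrite /balanced /V !wc_cat !wc_winv /=; move: c.
    move: (wc false None L) (wc true None L).
    move: (wc false None (cover_sub q i)) (wc true None (cover_sub q i)) => n3 n4 n1 n2 c.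
    have -> : (n1 + (n3 + n2) = n1 + n2 + n3)%N by lia.
    have -> : (n2 + (n4 + n1) = n1 + n2 + n4)%N by lia. rewrite eqn_modDl; exact: c.
  have [] := rw_ev b V (isT : 0 < p); rewrite rw_end // expg0 mul1g mulg1 => <- _.
  by rewrite !ev_cat ev_winv mulgA.
have sE i' : ev B (u (Some (s, i'))) = w * B (Some (s, i')) * w^-1 /\
             ev B2 (u (Some (s, i'))) = w * B1 (Some (s, i')) * w^-1.
  have BS (i : nat) : i < p -> B (S i) = b None ^+ i * b (Some s) * b None ^- i.
    by move=> ip; rewrite /B /S coverS inordK.
  have iE : Some (s, i') = S i' by rewrite /S inord_val.
  have wV (i : nat) : w^-1 = b None ^+ i * (w * b None ^+ i)^-1 by rewrite invgM mulVKg.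
  have hV (i : nat) : (ev B (o i))^-1 = b None ^+ f i * (w * b None ^+ i)^-1.
    by rewrite wE invgM mulVKg.
  have tE : lev B (None, false) = b None ^+ p by rewrite /lev /= /B coverN.
  have SE : (S (f i') == S e) = (S i' == S 0%N).
    rewrite /S !(inj_eq (@Some_inj _)) !xpair_eqE !eqxx /= -!val_eqE /= !inordK //; last exact: fp.
    have [->|i0] := eqVneq (i' : nat) 0%N; first by rewrite eqxx.
    by apply/negbTE/fi; rewrite lt0n i0 ltn_ord.
  rewrite /u /= eqxx !ev_cat !ev_cons !ev_winv !B2ns // iE hV (wV i').
  rewrite -![lev _ (S (f i'), false)]/((_ : option K -> F) (S (f i'))).
  rewrite /B1 /B2 !rmulE tE SE !BS //.
  have e1 : ev B (o i') * (b None ^+ f i' * b (Some s) * b None ^- f i' *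
       (b None ^+ f i' * (w * b None ^+ i')^-1)) =
     w * b None ^+ i' * b (Some s) * (w * b None ^+ i')^-1.
    by rewrite !mulgA mulgVK -wE.
  have e2 : w * (b None ^+ i' * b (Some s) * b None ^- i') *
       (b None ^+ i' * (w * b None ^+ i')^-1) =
     w * b None ^+ i' * b (Some s) * (w * b None ^+ i')^-1.
    by rewrite !mulgA mulgVK.
  rewrite e1 e2; split=> //; case: ifP => _; last by rewrite e1 e2.
  have e3 (g y z v : F) (n r : nat) :
    g * (y ^+ n * z * y ^- n * y ^+ r) * (y ^+ n * v) = g * y ^+ n * z * y ^+ r * v.
    rewrite -!mulgA; congr (_ * (_ * (_ * _))).
    by rewrite [y ^+ r * _]mulgA -expgnDr addnC expgnDr -mulgA mulKg.
  by rewrite e3 mulgA e3 -wE.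
have uE i : ev B (u i) = w * B i * w^-1 /\ ev B2 (u i) = w * B1 i * w^-1.
  case: i => [[j i]|]; last exact: nsE.
  by have [->|js] := eqVneq j s; [exact: sE|exact: nsE].
have r1 : reach k.+1 B1 by apply: reach_rmul.
have r2 : reach k.+1 B2 by apply: reach_rmul.
have [f1 c1] := reach_carries rB r1; have [f2 c2] := reach_carries rB r2.
(* The conjugate of [f1] by [inn p w] agrees with [f2] on the conjugate basis. *)
have f12 : inn p w * f1 * (inn p w)^-1 = f2.
  have cw := carries_conj (carries_inn p w B) (carries_inn p w B1) c1.
  have [_ oB] := carries_pbasis (carries_inn p w B) (reach_pbasis rB).
  apply: (carries_uniq oB cw).
  have -> : conj_fun w \o B = sub u B by apply/funext => i; rewrite /sub (uE i).1.
  have -> : conj_fun w \o B1 = sub u B2 by apply/funext => i; rewrite /sub (uE i).2.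
  exact: carries_sub.
have ef1 : elem f1 by exact: (@elem_gen q m F x0 k.+1 B (S 0%N) None f1 rB isT c1).
have N12 : N (f1 * f2^-1).
  rewrite -[f1 * _]invgK; apply: subgroupV => //; rewrite invgM invgK -f12.
  exact: normal_comm.
have [a0 a0s] : exists a0 : Jx k, a0 != s.
  have [j [l jl]] := Jx_neq k; have [js|js] := eqVneq j s; last by exists j.
  by exists l; rewrite eq_sym -js.
pose a : option K := Some (a0, ord0).
have aS i : a != S i by rewrite /a /S (inj_eq (@Some_inj _)) xpair_eqE negb_and a0s.
have SS : S 0%N != S e.
  rewrite /S (inj_eq (@Some_inj _)) xpair_eqE eqxx /= -val_eqE /= !inordK //; last exact: fp.
  by rewrite eq_sym.
have rD : reach k.+1 (rmul a (S 0%N, false) B) by apply: reach_rmul; rewrite // eq_sym aS.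
have [D cD] := reach_carries rB rD.
have eD : elem D by exact: (@elem_gen q m F x0 k.+1 B a (S 0%N) D rB (aS _) cD).
(* As [f2] commutes with [D], the commutator of [f1 * f2^-1] and [D^-1] is that of
   [f1] and [D^-1]. *)
have comm : f2 * D = D * f2.
  apply: (reach_uniq rB).
    exact: (carries_mul cD (carries_sub (rsub a (S 0%N, false)) c2)).
  rewrite -/(rmul _ _ _) rmulC //.
  exact: (carries_mul c2 (carries_sub (rsub (S e) (None, false)) cD)).
have Nn : N (f1 * D^-1 * f1^-1 * D).
  have := normal_comm N12 (elemV eD).
  rewrite invgM !invgK -!mulgA (mulgA f2^-1 D^-1) -invgM -comm invgM -!mulgA.
  by rewrite (mulgA f2^-1 f2) mulVg mul1g.
have Sa : S 0%N != a by rewrite eq_sym.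
have D' := @carries_rmulV p F _ D B a (S 0%N, false) Sa cD.
have f1' := @carries_rmulV p F _ f1 B (S 0%N) (None, false) isT c1.
pose s1 := rsub (S 0%N) (None, true); pose sD := rsub a (S 0%N, false).
have cn : carries (f1 * D^-1 * f1^-1 * D) B (rmul a (None, true) B).
  have h1 := carries_mul cD (carries_sub sD f1').
  have h2 := carries_mul h1 (carries_sub sD (carries_sub s1 D')).
  have h3 := carries_mul h2
    (carries_sub sD (carries_sub s1 (carries_sub (rsub a (S 0%N, true)) c1))).
  have -> : rmul a (None, true) B =
      rmul a (S 0%N, false) (rmul (S 0%N) (None, true) (rmul a (S 0%N, true) B1)).
    by rewrite rmul_commutator // ?aS.
  by rewrite -!mulgA; exact: h3.
have Nn' := subgroupV sN Nn.
apply: (@level_one k.+1 B a None _ rB isT _ Nn').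
exact: (@carries_rmulV p F _ (f1 * D^-1 * f1^-1 * D) B a (None, true) isT cn).
Qed.

(** Conjugation by [b None] is a product of transvections of [b], and satisfies
    the hypotheses of [level_core]. *)
Lemma level_up k : level k -> level k.+1.
Proof.
move=> lv.
have [b rb] : exists b, reach k b.
  elim: (k) => [|n [b rb]]; first by exists bstar; exact: bstar_reach.
  by exists (cover q b); exact: reach_cover.
apply: (@level_core k b (J0 q m k) [:: (None, false)]) => //.
rewrite ev1; apply: (carries_tequiv sN lv rb (tequiv_conj b None)).
exact: carries_inn.
Qed.

Lemma level_all k l : level k -> level l.
Proof.
have down n : level n -> level 0 by elim: n => // n IH /level_down/IH.
by move=> /down l0; elim: l => // n; exact: level_up.
Qed.

Lemma inn_conj_power k (b : option (Jx k) -> F) w i : reach k b ->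
  N (inn p w) -> N (inn p (b None ^+ i * w * b None ^- i)).
Proof.
move=> rb Nw; rewrite !innM innV; apply: normal_conj => //.
apply: elem_inn; apply: Defs.subgroupX; first exact: span_subgroup.
by apply: (reach_span rb); exact: span_gen.
Qed.

(** As long as all exponent sums are divisible by [p], the word can be rewritten
    in the cover with respect to any of its letters; up to conjugation this
    makes it shorter, and a nontrivial word cannot become empty. *)
Lemma unbalanced_ex n k (b : option (Jx k) -> F) L : size L <= n -> reach k b ->
    N (inn p (ev b L)) -> ev b L != 1 ->
  exists k (b : option (Jx k) -> F) L x, [/\ reach k b, N (inn p (ev b L)) & ~~ balanced p x L].
Proof.
elim: n k b L => [|n IH] k b L.
  by rewrite leqn0 size_eq0 => /eqP-> _ _; rewrite eqxx.
move=> sL rb Nw w1.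
have [[x ux]|nu] := pselect (exists x, ~~ balanced p x L); first by exists k, b, L, x.
case: L sL Nw w1 nu => [|[x0' e0] L0]; first by rewrite eqxx.
set L := (_ :: L0) => sL Nw w1 nu.
pose s := tperm None x0'; pose b' := b \o s; pose L' := lmap s L.
have rb' : reach k b' by apply: reach_nequiv rb; exact: nequiv_perm.
have ee : ev b' L' = ev b L := lmap_tperm b None x0' L.
have bal : balanced p None L'.
  rewrite -(tpermR None x0') -/s balanced_lmap; apply: contrapT => h.
  by apply: nu; exists x0'; apply/negP.
have occ0 : 0 < occ None L' by rewrite /L' /L /= occ_cons /s /= tpermR.
have [i ip /(_ occ0) lt] := rw_shorter q L'.
have rc : reach k.+1 (cover q b') := reach_cover rb'.
apply: (IH k.+1 _ (rw q i L').1 _ rc).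
- have := rw_size q i L'; rewrite size_lmap.
  have ar (s1 o1 s2 o2 : nat) : (o2 < o1 -> s2 <= n.+1 -> s1 + o1 = s2 + o2 -> s1 <= n)%N by lia.
  exact: ar lt sL.
- by rewrite -(cover_conj b' ip bal) ee; exact: inn_conj_power.
- rewrite -(cover_conj b' ip bal) ee; apply: contra w1 => /eqP e.
  rewrite -(inj_eq (mulIg (b' None ^- i))) -(inj_eq (mulgI (b' None ^+ i))).
  by rewrite mulgA e mul1g mulgV.
Qed.

(** The commutator of [w] with the transvection [y -> y * x] has the exponent
    sum of [y] in [w] as its exponent sum in [x], and no others. *)
Lemma single_exponent k (b : option (Jx k) -> F) L y : reach k b ->
    N (inn p (ev b L)) -> ~~ balanced p y L ->
  exists (b : option (Jx k) -> F) L x, [/\ reach k b, N (inn p (ev b L)),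
    wc false None L = wc true None L & ~~ balanced p (Some x) L].
Proof.
move=> rb Nw uy.
have [x xy] : exists x, x != y.
  by case: (y) => [y'|]; [exists None|exists (Some (J0 q m k))].
have rr : reach k (rmul y (x, false) b) by apply: reach_rmul.
have [al alb] := reach_carries rb rr.
have eal : elem al by apply: (elem_gen rb _ alb); rewrite eq_sym.
pose L2 := winv L ++ wsub (rsub y (x, false)) L.
have NL2 : N (inn p (ev b L2)).
  have := subgroupM sN (subgroupV sN Nw) (normal_conj Nw eal).
  rewrite (carries_inn_conj alb (erefl _)) -innV -innM.
  by rewrite /L2 ev_cat ev_winv -ev_sub.
have w2 e z : wc e z L2 = (wc (~~ e) z L + (wc e z L + (z == x) * wc e y L))%N.
  by rewrite wc_cat wc_winv wc_rsub.
pose s := tperm None y; pose b' := b \o s; pose L' := lmap s L2.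
have rb' : reach k b' by apply: reach_nequiv rb; exact: nequiv_perm.
have yE : s y = None by rewrite /s tpermR.
have xE : s x != None by rewrite -yE (inj_eq perm_inj).
case e : (s x) xE => [x'|] // _.
exists b', L', x'; split=> //.
- by rewrite /L' /b' lmap_tperm.
- rewrite /L' -{1 2}yE !wc_lmap !w2 [y == x]eq_sym (negPf xy) !mul0n !addn0.
  exact: addnC.
- rewrite -e balanced_lmap; apply: contra uy; rewrite /balanced !w2 eqxx !mul1n /=.
  move: (wc false x L) (wc true x L) (wc false y L) (wc true y L) => n1 n2 n3 n4.
  have -> : (n2 + (n1 + n3) = n1 + n2 + n3)%N by lia.
  have -> : (n1 + (n2 + n4) = n1 + n2 + n4)%N by lia.
  by rewrite eqn_modDl.
Qed.

(** Since the exponent sum of [None] vanishes, the word can be rewritten in the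
    cover, and up to conjugation the number of letters [None] decreases.  The
    exponent sums of the lifts of [x] add up to the exponent sum of [x], so
    that one of them is again prime to [p]. *)
Lemma level_ex n k (b : option (Jx k) -> F) L x : occ None L <= n -> reach k b ->
    N (inn p (ev b L)) -> wc false None L = wc true None L -> ~~ balanced p (Some x) L ->
  exists k, level k.
Proof.
elim: n k b L x => [|n IH] k b L x oL rb Nw wN ux.
  pose s := tperm None (Some x); pose b' := b \o s; pose L' := lmap s L.
  have rb' : reach k b' by apply: reach_nequiv rb; exact: nequiv_perm.
  exists k.+1; apply: (@level_core k b' x L' rb').
  - by rewrite /L' /b' lmap_tperm.
  - by apply/eqP; rewrite -leqn0 -(tpermL None (Some x)) occ_lmap.
  - by rewrite -(tpermR None (Some x)) balanced_lmap.
have [o0|o0] := posnP (occ None L); first by apply: (IH k b L x) => //; rewrite o0.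
have [i ip /(_ o0) lt] := rw_shorter q L.
have bal : balanced p None L by rewrite /balanced wN.
have rc : reach k.+1 (cover q b) := reach_cover rb.
have [i' ui'] : exists i', ~~ balanced p (Some (x, i')) (rw q i L).1.
  apply: contrapT => h; move: ux; rewrite /balanced -!(rw_wcS q i).
  move=> /negP; apply; apply/eqP.
  rewrite -[LHS]modn_summ -[RHS]modn_summ; congr (_ %% _)%N; apply: eq_bigr => j _.
  by apply/eqP; apply: contrapT => hj; apply: h; exists j; apply/negP.
apply: (IH k.+1 (cover q b) (rw q i L).1 (x, i') _ rc) => //.
- by rewrite -ltnS; apply: leq_trans oL.
- by rewrite -(cover_conj b ip bal); exact: inn_conj_power.
- exact: rw_wcN0.
Qed.

(** The commutator of [f] and the conjugation by [u] is the conjugation by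
    [f u * u^-1]. *)
Lemma normal_inn_ex n : N n -> n != 1 -> exists w, [/\ w != 1, span bstar w & N (inn p w)].
Proof.
elim/quotW: n => f Nf f1.
have [_ os] := bstar_pbasis p_prime x0_free x0_span.
have [ss _] := os.
pose U := pdom f `&` f @^-1` span bstar `&` span bstar.
have oU : p_open_subgroup p U.
  apply: p_openI => //; apply: p_open_preimage => //; [exact: pdom_open|exact: pfunM].
have [u [[[du su'] su] fu]] : exists u, U u /\ f u <> u.
  apply: contrapT => h; move/eqP: f1; apply; apply/pcomm_piP; exists U; split=> //.
    by move=> u [[du _] _]; split.
  move=> u /set_mem Uu /=; apply: contrapT => fu; apply: h; by exists u.
exists (f u * u^-1); split.
- by apply/eqP => /divg1_eq.
- by apply: subgroupM => //; exact: subgroupV.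
- rewrite innM innV -(inn_conj du).
  exact: normal_comm Nf (elem_inn su).
Qed.

Lemma normal_all : N <> [set 1] -> N = elem.
Proof.
move=> N1.
have [n Nn n1] : exists2 n, N n & n != 1.
  apply: contrapT => h; apply: N1; apply/seteqP; split=> [n Nn|_ ->]; last exact: subgroup1.
  by apply: contrapT => n1; apply: h; exists n => //; apply/eqP.
have [w [w1 [L eL] Nw]] := normal_inn_ex Nn n1.
rewrite -eL in w1 Nw.
have [k [b [L1 [x [rb Nb ux]]]]] := @unbalanced_ex _ 0 bstar L (leqnn _) (bstar_reach q x0) Nw w1.
have [b' [L' [x' [rb' Nb' wN ux']]]] := single_exponent rb Nb ux.
have [l lv] := @level_ex _ k b' L' x' (leqnn _) rb' Nb' wN ux'.
apply/seteqP; split; first by case: nN.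
move=> c; elim=> [|k' b0 i j c0 rb0 ij cb0|c0 d0 _ Nc _ Nd|c0 _ Nc].
- exact: subgroup1.
- exact: (@level_all l k' lv b0 i j c0 rb0 ij cb0).
- exact: subgroupM.
- exact: subgroupV.
Qed.

End Normal.

(** A transvection [b_i -> b_i * b_j] moves all powers of [b_i], hence is
    nontrivial on every p-open subgroup. *)
Lemma elem_nontrivial : elem <> [set 1].
Proof.
move=> e1.
pose i : option (Jx 0) := None; pose j : option (Jx 0) := Some (J0 q m 0).
have rb := bstar_reach q x0; have rr := reach_rmul (isT : (j, false).1 != i) rb.
have [c cb] := reach_carries rb rr.
have : elem c by exact: (elem_gen rb _ cb).
rewrite e1 => c1; move: cb; rewrite {}c1 => -[f [f1 sf fb]].
have /pcomm_piP[W [oW sW fW]] :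
    (\pi_(pcomm p F) f = \pi_(pcomm p F) (p_iso_id p F))%qT by exact: f1.
have /p_openP[_ [V /p_normalP[_ _ [n pn Vn]] VW]] := oW.
have := fW _ (mem_set (VW _ (Vn (bstar i)))).
pose u := nseq n (i, false); pose v := flatten (nseq n [:: (i, false); (j, false)]).
have uE (G : groupType) (h : option (Jx 0) -> G) : ev h u = h i ^+ n by rewrite ev_nseq.
have vE (G : groupType) (h : option (Jx 0) -> G) : ev h v = (h i * h j) ^+ n.
  by rewrite /v; elim: (n) => [|n' IH] //; rewrite expgS -IH -mulgA.
rewrite -[bstar i ^+ n]uE pfun_ev // !uE /= fb rmulE eqxx => fu.
have e : ev bstar v = ev bstar u by rewrite vE uE.
pose h (k : option (Jx 0)) : 'I_n.+2 := if k is None then Zp0 else Zp1.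
have := free_tuple_eq (h : _ -> ('I_n.+2 : groupType)) (reach_pbasis rb).1 e.
rewrite vE uE /h /= !Zp_expg => /(congr1 val) /=.
have n0 : 0 < n by case/andP: pn.
by rewrite !(modn_small, add0n, mul1n, mul0n) // => n0'; rewrite n0' in n0.
Qed.

End Simplicity.

(** * The main theorem *)

Section Rank.
Local Open Scope group_scope.

Lemma span_commute (I : Type) (G : groupType) (b : I -> G) :
  (forall i j, commute (b i) (b j)) -> forall u v, span b u -> span b v -> commute u v.
Proof.
move=> cb.
have cent (g : G) : (forall i, commute g (b i)) -> span b `<=` [set u | commute g u].
  move=> cg; apply: span_min; last exact: cg.
  apply/subgroupP; split; first exact: commute1.
  by move=> u v cu cv; apply: commuteM => //; exact: commuteV.
move=> u v su; apply: (cent u) => i; apply: commute_sym.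
by apply: (cent (b i)) su => j; exact: cb.
Qed.

(** The index type [option 'I_m.+1] singles out the entry used for coverings. *)
Lemma free_basis (F : groupType) : free_of_finite_rank F -> nonabelian_group F ->
  exists m (x0 : option 'I_m.+1 -> F), free_tuple x0 /\ span x0 = setT.
Proof.
move=> [n [x fx]] [u [v nuv]].
have ft := free_on_tuple fx; have sp := free_on_span fx.
have n2 : 1 < n.
  rewrite ltnNge; apply/negP => n1; apply: nuv.
  apply: (@span_commute _ _ x); rewrite ?sp // => i j.
  have z (k : 'I_n) : k = 0%N :> nat.
    by apply/eqP; rewrite -leqn0 -ltnS; exact: leq_trans (ltn_ord k) n1.
  have -> : i = j by apply: val_inj; rewrite /= !z.
  exact: commute_refl.
case: n x fx ft sp n2 => [|[|m]] // x fx ft sp _; exists m.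
pose r (k : option 'I_m.+1) : 'I_m.+2 := if k is Some j then lift ord0 j else ord0.
have rK (i : 'I_m.+2) : exists k, r k = i.
  have [->|[j ->]] : i = ord0 \/ exists j, i = lift ord0 j.
    by case: (unliftP ord0 i) => [j ->|->]; [right; exists j|left].
  - by exists None.
  - by exists (Some j).
have /choice[r' r'K] := rK.
have rinj : injective r.
  by move=> [j|] [j'|] //= /lift_inj->.
exists (x \o r); split.
  move=> H h L; have e : x \o r = sub (fun k => [:: (r k, false)]) x.
    by apply/funext => k; rewrite /sub ev1.
  rewrite e ev_sub => /(ft _ (h \o r')); rewrite -ev_sub.
  suff -> : sub (fun k => [:: (r k, false)]) (h \o r') = h by [].
  by apply/funext => k; rewrite /sub ev1 /lev /=; congr h; apply: rinj; rewrite r'K.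
rewrite -sp; apply/seteqP; split; apply: span_trans => k; first exact: span_gen.
by have [k' <-] := rK k; exact: (span_gen (x \o r) k').
Qed.

End Rank.

Theorem theoremC (p : nat) (p_prime : prime p) (F : groupType)
    (F_free : free_of_finite_rank F) (F_nonab : nonabelian_group F) :
  exists S : set (pcomm p F), simple_subgroup S /\ left_cosets S #<= `I_2.
Proof.
case: p p_prime => [|[|q]] // p_prime.
have [m [x0 [x0_free x0_span]]] := free_basis F_free F_nonab.
exists (@elem q m F x0); split; last exact: elem_index.
split; [exact: elem_subgroup|exact: elem_nontrivial|].
move=> N nN; have [->|N1] := pselect (N = [set monoid.one]); first by left.
by right; exact: (normal_all p_prime x0_free x0_span nN).
Qed.
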